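(* Let $\nu$ be a pm valuation on $K(\chi)$, $d$ be an independent key degree, and $\Phi$ be a monic polynomial of degree $d$ such that $\nu(\Phi)$ is the maximum of $\nu(\chi^d-K_{d-1}[\chi])$. Let $d'$ be the next key degree (the smallest key degree greater than $d$) if it exists, or $d'=[K[\chi]:K]$ otherwise. 1) $\Phi$ is a key polynomial, and $d'$ is the smallest degree such that there exists a monic polynomial $\Phi'$ of degree $d'$ with $\nu_\Phi(\Phi')<\nu(\Phi')$. 2) The restrictions of $\nu$ and $\nu_\Phi$ to $K_{d'-1}[\chi]$ are equal. 3) If $d<[K[\chi]:K]/2$, then $G_\nu(K_{d'-1}[\chi])$ is a graded algebra and the fraction $d'/d$ is equal to the dimension of the $G_\nu(K_{d-1}[\chi])$-module $G_\nu(K_{d'-1}[\chi])$. 4) If $(K_{d-1}[\chi]|K,\nu)$ is vs defectless, then $(K_{d'-1}[\chi]|K,\nu)$ is vs defectless.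
   Context: $K$ is a field, $\chi\notin K$ is algebraic or transcendental over $K$; $[K[\chi]:K]=\infty$ if $\chi$ is transcendental. When $\chi$ is algebraic, elements of $K[\chi]$ are written uniquely as polynomials in $\chi$ of degree $<[K[\chi]:K]$. $K_m[\chi]$ is the $K$-module of polynomials of degree at most $m$, $K_\infty[\chi]=K[\chi]$ ($\infty-1=\infty$). A $K$-module valuation is a map $\nu$ to $\Gamma\cup\{\infty\}$, $\Gamma$ a linearly ordered abelian group, such that $\nu(y)=\infty\Leftrightarrow y=0$, $\nu(y_1+y_2)\ge\min(\nu(y_1),\nu(y_2))$ and $\nu(xy)=\nu(x)+\nu(y)$ for $x\in K$. It is a pm (partially multiplicative) valuation if $\nu(fg)=\nu(f)+\nu(g)$ for all $f,g\in K[\chi]$ with $\deg(f)+\deg(g)<[K[\chi]:K]$; if $\chi$ is transcendental one requires moreover that $\nu$ is a field valuation on $K(\chi)$. It is assumed that $\nu K$ has finite rank. $\nu(\chi^d-K_{d-1}[\chi])$ is the set of values ($\infty$ excluded) of monic polynomials of degree $d$. For $\Phi$ monic of degree $d$, $1\le d<[K[\chi]:K]$, and $f,g\in K_{d-1}[\chi]$, $q_\Phi(f,g)$ and $r_\Phi(f,g)$ are the quotient and remainder of the euclidean division of $fg$ by $\Phi$. $\Phi$ is a key polynomial for $\nu$ if $\nu(fg)=\nu(r_\Phi(f,g))<\nu(q_\Phi(f,g)\Phi)$ for all nonzero $f,g\in K_{d-1}[\chi]$ with $\deg(f)+\deg(g)<[K[\chi]:K]$. $d$ is a key degree if there is a key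 polynomial of degree $d$; it is independent if moreover $\nu(\chi^d-K_{d-1}[\chi])$ has a maximal element. For $f=f_0+f_1\Phi+\cdots+f_m\Phi^m$ with $f_i\in K_{d-1}[\chi]$, set $\nu_\Phi(f):=\min_{0\le i\le m}(\nu(f_i)+i\nu(\Phi))$. In 1), if $d'=[K[\chi]:K]$ is finite, $\Phi'$ is allowed to be the minimal polynomial of $\chi$ over $K$, with $\nu(\Phi')=\infty$ and $\nu_\Phi(\Phi')$ computed from its formal $\Phi$-expansion; if $d'=\infty$, the assertion means that no such $\Phi'$ exists. For a $K$-submodule $M$, with $\nu M=\{\nu(x):x\in M\}\setminus\{\infty\}$, $M_{\gamma,\nu}:=\{x\in M:\nu(x)\ge\gamma\}/\{x\in M:\nu(x)>\gamma\}$ and $G_\nu(M):=\bigoplus_{\gamma\in\nu M}M_{\gamma,\nu}$ (additive group); $in_\nu(x)$ denotes the class of $x\neq 0$ in $M_{\nu(x),\nu}$. Multiplication is that of the graded algebra $G_\nu(K(\chi))$, determined by $in_\nu(x)in_\nu(y)=in_\nu(xy)$; ''$G_\nu(M)$ is a graded algebra'' means that it is a subalgebra for this multiplication. (For a key degree $d\le[K[\chi]:K]/2$, $G_\nu(K_{d-1}[\chi])$ is such an algebra.) In 3), $d'/d=\infty$ if $d'=\infty$. A sequence $(l_1,\dots,l_n)$ is separated over $K$ if $\nu(x_1l_1+\cdots+x_nl_n)=\min_i\nu(x_il_i)$ for all $x_i\in K$. For a $K$-module $N\supseteq K$, $(N|K,\nu)$ is vs defectless if every finitely generated $K$-submodule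 of $N$ admits a basis separated over $K$.
   Formalization: Part 3 additionally assumes that ν is a field valuation on K(χ), or that d' is finite with 2(d'−1)<[K[χ]:K]; otherwise in(x)in(y)=in(xy) need not define a graded multiplication (χ^5=2 over Q, ν=min(v_2(a_i)+i√2), d=1, d'=5). *)

(* Defs.v *)
From HB Require Import structures.
From mathcomp Require Import all_boot all_order all_algebra.
From mathcomp Require Import boolp classical_sets cardinality.

Set Implicit Arguments.
Unset Strict Implicit.
Unset Printing Implicit Defensive.

Import Order.TTheory GRing.Theory Num.Theory.

Local Open Scope classical_set_scope.
Local Open Scope ring_scope.

(* [porderZmodType] does not relate the order and the addition. *)
Definition linearly_ordered_group (Gamma : porderZmodType) : Prop :=
  (forall x y : Gamma, (x <= y) || (y <= x)) /\
  (forall x y z : Gamma, y <= z -> x + y <= x + z).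

Section ExtendedValues.
Variable Gamma : porderZmodType.

(* [option Gamma] is Gamma with infinity added: [None] is infinity. *)
Definition vle (a b : option Gamma) : bool :=
  match a, b with
  | _, None => true
  | None, Some _ => false
  | Some x, Some y => x <= y
  end.

Definition vlt (a b : option Gamma) : bool := ~~ vle b a.

Definition vmin (a b : option Gamma) : option Gamma := if vle a b then a else b.

Definition vadd (a b : option Gamma) : option Gamma :=
  match a, b with
  | Some x, Some y => Some (x + y)
  | _, _ => None
  end.

Definition vmuln (a : option Gamma) (n : nat) : option Gamma :=
  omap (fun x => x *+ n) a.

Definition is_max (S : set Gamma) (g : Gamma) : Prop :=
  S g /\ forall h, S h -> h <= g.

Definition is_subgroup (S : set Gamma) : Prop :=
  S 0 /\ forall x y, S x -> S y -> S (x - y).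

Definition convex_subgroup (S H : set Gamma) : Prop :=
  [/\ H `<=` S, is_subgroup H
    & forall x y, S x -> H y -> 0 <= x -> x <= y -> H x].

(* The rank is the number of proper convex subgroups. *)
Definition finite_rank (S : set Gamma) : Prop :=
  finite_set [set H | convex_subgroup S H].

End ExtendedValues.

(* Elements of nat + {infinity} are encoded in [option nat], with [None]
   standing for infinity. *)
Definition ltn_ext (n : nat) (e : option nat) : bool :=
  if e is Some m then (n < m)%N else true.

Section Setting.
Variables (K L : fieldType) (iota : {rmorphism K -> L}) (chi : L).

Definition ev (p : {poly K}) : L := (map_poly iota p).[chi].

Definition generated_by_chi : Prop :=
  forall z : L, exists p q : {poly K}, ev q != 0 /\ z = ev p / ev q.

(* [Kpoly e] is K_{e-1}[chi], the K-module of the values at chi of the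
   polynomials of degree < e; [Kpoly None] is K[chi]. *)
Definition Kpoly (e : option nat) : set L :=
  [set z | exists2 p : {poly K}, (forall n, e = Some n -> (size p <= n)%N)
                               & z = ev p].

Definition lincomb n (c : 'I_n -> K) (x : 'I_n -> L) : L :=
  \sum_(i < n) iota (c i) * x i.

Definition lin_free n (x : 'I_n -> L) : Prop :=
  forall c : 'I_n -> K, lincomb c x = 0 -> forall i, c i = 0.

Definition lin_span n (x : 'I_n -> L) : set L :=
  [set z | exists c : 'I_n -> K, z = lincomb c x].

Definition is_lin_basis (M : set L) n (x : 'I_n -> L) : Prop :=
  lin_free x /\ lin_span x = M.

(* [ext_degree N] says that N = [K[chi] : K]. *)
Definition ext_degree (N : option nat) : Prop :=
  if N is Some n then exists x : 'I_n -> L, is_lin_basis (Kpoly None) x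
  else forall n (x : 'I_n -> L), ~ is_lin_basis (Kpoly None) x.

Definition is_minpoly (p : {poly K}) : Prop :=
  [/\ p \is monic, ev p = 0 & forall q, ev q = 0 -> p %| q].

Variables (N : option nat) (Gamma : porderZmodType) (nu : L -> option Gamma).

Definition value_set (M : set L) : set Gamma :=
  [set g | exists2 x, M x & nu x = Some g].

Definition K_module_valuation (M : set L) : Prop :=
  [/\ forall y, M y -> (nu y = None <-> y = 0),
      forall y z, M y -> M z -> vle (vmin (nu y) (nu z)) (nu (y + z))
    & forall a y, M y -> nu (iota a * y) = vadd (nu (iota a)) (nu y)].

Definition field_valuation : Prop :=
  [/\ forall y, nu y = None <-> y = 0,
      forall y z, vle (vmin (nu y) (nu z)) (nu (y + z))
    & forall y z, nu (y * z) = vadd (nu y) (nu z)].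

(* An element of K[chi] is given by its polynomial representative of degree
   < N; if deg f + deg g < N, then f, g and f * g are such representatives.
   [(size f).-1] is the degree of f, also when f is constant. *)
Definition pm_valuation : Prop :=
  [/\ K_module_valuation (Kpoly None),
      forall f g : {poly K}, ltn_ext ((size f).-1 + (size g).-1) N ->
        nu (ev (f * g)) = vadd (nu (ev f)) (nu (ev g))
    & N = None -> field_valuation].

(* nu(chi^d - K_{d-1}[chi]), infinity excluded. *)
Definition monic_values (d : nat) : set Gamma :=
  [set g | exists p : {poly K},
     [/\ p \is monic, size p = d.+1 & nu (ev p) = Some g]].

Definition key_poly (d : nat) (Phi : {poly K}) : Prop :=
  [/\ Phi \is monic, size Phi = d.+1, (1 <= d)%N /\ ltn_ext d N
    & forall f g : {poly K}, f != 0 -> g != 0 ->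
        (size f <= d)%N -> (size g <= d)%N ->
        ltn_ext ((size f).-1 + (size g).-1) N ->
        nu (ev (f * g)) = nu (ev ((f * g) %% Phi)) /\
        vlt (nu (ev ((f * g) %% Phi))) (nu (ev ((f * g) %/ Phi * Phi)))].

Definition key_degree (d : nat) : Prop := exists Phi, key_poly d Phi.

Definition independent_key_degree (d : nat) : Prop :=
  key_degree d /\ exists g, is_max (monic_values d) g.

(* [next_key_degree d d']: d' is the smallest key degree greater than d, or
   [K[chi] : K] if there is no key degree greater than d. *)
Definition next_key_degree (d : nat) (d' : option nat) : Prop :=
  (exists e, [/\ d' = Some e, (d < e)%N, key_degree e
     & forall e', (d < e')%N -> key_degree e' -> (e <= e')%N]) \/
  ((forall e, (d < e)%N -> ~ key_degree e) /\ d' = N).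

(* The i-th coefficient of the Phi-expansion of f. *)
Definition phi_coef (Phi f : {poly K}) (i : nat) : {poly K} :=
  (f %/ Phi ^+ i) %% Phi.

(* f has at most [size f] nonzero coefficients in its Phi-expansion (see
   [phi_expansion]); the zero ones contribute the neutral value infinity. *)
Definition nu_Phi (Phi f : {poly K}) : option Gamma :=
  \big[@vmin Gamma/None]_(i < size f)
     vadd (nu (ev (phi_coef Phi f i))) (vmuln (nu (ev Phi)) i).

(* There is a monic Phi' of degree e with nu_Phi(Phi') < nu(Phi'), where Phi'
   is the representative of an element of K[chi] or the minimal polynomial of
   chi; in the latter case nu (ev Phi') = nu 0 is infinite. *)
Definition jump_degree (Phi : {poly K}) (e : nat) : Prop :=
  exists Phi' : {poly K},
    [/\ Phi' \is monic, size Phi' = e.+1, ltn_ext e N \/ is_minpoly Phi'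
      & vlt (nu_Phi Phi Phi') (nu (ev Phi'))].

Definition smallest_jump_degree (Phi : {poly K}) (d' : option nat) : Prop :=
  if d' is Some e then
    jump_degree Phi e /\ forall k, jump_degree Phi k -> (e <= k)%N
  else forall k, ~ jump_degree Phi k.

(* The class of x modulo {y | nu(y) > g}. *)
Definition coset (g : Gamma) (x : L) : set L :=
  [set y | vlt (Some g) (nu (y - x))].

(* An element of the direct sum of the quotients {nu >= g} / {nu > g} is the
   family of its components, each of them being a class. *)
Definition gr : Type := Gamma -> set L.

Definition gr0 : gr := fun g => coset g 0.

Definition grD (u v : gr) : gr := fun g => [set x + y | x in u g & y in v g].

Definition gr_in (x : L) : gr :=
  fun g => coset g (if nu x == Some g then x else 0).

(* [G M] is G_nu(M), as a subgroup of G_nu(K(chi)): M_{g,nu} embeds in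
   K(chi)_{g,nu}, and it is zero when g is not in nu M. *)
Definition G (M : set L) : set gr :=
  [set u | (forall g, exists x, [/\ M x, vle (Some g) (nu x) & u g = coset g x])
           /\ finite_set [set g | u g <> gr0 g]].

Definition gr_homogeneous (g : Gamma) (u : gr) : Prop :=
  forall h, h <> g -> u h = gr0 h.

(* As G_nu(M) is additively generated by the in_nu(x), a biadditive
   multiplication is determined on it by in_nu(x) in_nu(y) = in_nu(xy). *)
Record graded_algebra (mu : gr -> gr -> gr) (M : set L) : Prop := GradedAlgebra {
  gr_closed : forall u v, G M u -> G M v -> G M (mu u v);
  gr_one : G M (gr_in 1);
  gr_mul_in : forall x y, M x -> M y -> x != 0 -> y != 0 ->
    mu (gr_in x) (gr_in y) = gr_in (x * y);
  gr_graded : forall g h u v, G M u -> G M v ->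
    gr_homogeneous g u -> gr_homogeneous h v -> gr_homogeneous (g + h) (mu u v);
  gr_mulDl : forall u v w, G M u -> G M v -> G M w ->
    mu (grD u v) w = grD (mu u w) (mu v w);
  gr_mulA : forall u v w, G M u -> G M v -> G M w ->
    mu u (mu v w) = mu (mu u v) w;
  gr_mulC : forall u v, G M u -> G M v -> mu u v = mu v u;
  gr_mul1 : forall u, G M u -> mu (gr_in 1) u = u
}.

Definition gr_lincomb (mu : gr -> gr -> gr) n (a b : 'I_n -> gr) : gr :=
  \big[grD/gr0]_(i < n) mu (a i) (b i).

(* B is a basis of the G_nu(A)-module G_nu(M). *)
Definition gr_basis (mu : gr -> gr -> gr) (A M : set L) (B : set gr) : Prop :=
  [/\ B `<=` G M,
      forall n (a b : 'I_n -> gr), injective b ->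
        (forall i, B (b i)) -> (forall i, G A (a i)) ->
        gr_lincomb mu a b = gr0 -> forall i, a i = gr0
    & forall u, G M u -> exists n (a b : 'I_n -> gr),
        [/\ forall i, B (b i), forall i, G A (a i) & u = gr_lincomb mu a b]].

(* d' / d is the dimension of the G_nu(A)-module G_nu(M). *)
Definition gr_dim_fraction (mu : gr -> gr -> gr) (A M : set L)
    (d' : option nat) (d : nat) : Prop :=
  exists2 B, gr_basis mu A M B &
    if d' is Some e then exists2 n, (B #= `I_n)%card & e%:R / d%:R = n%:R :> rat
    else infinite_set B.

(* The products of elements of K_{d'-1}[chi] are covered either by the partial
   multiplicativity of nu, all the degrees involved being < [K[chi] : K], or by
   the fact that nu is multiplicative on K(chi), i.e. that G_nu(K(chi)) is a
   graded algebra for in_nu(x) in_nu(y) = in_nu(xy).  Otherwise this formula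
   need not define a multiplication: if nu(sum_(i < 5) a_i chi^i) is the
   minimum of the nu(a_i) + i g, where chi has degree 5, chi^5 = a is in K and g
   is not torsion modulo nu K, then nu is a pm valuation, but
   nu(chi^2 chi^3) = nu(a) <> nu(chi^2) + nu(chi^3). *)
Definition gr_mul_available (d' : option nat) : Prop :=
  (exists2 e, d' = Some e & ltn_ext (e.-1 + e.-1) N) \/ field_valuation.

Definition separated n (l : 'I_n -> L) : Prop :=
  forall c : 'I_n -> K,
    nu (lincomb c l) = \big[@vmin Gamma/None]_(i < n) nu (iota (c i) * l i).

Definition vs_defectless (M : set L) : Prop :=
  forall m (x : 'I_m -> L), (forall i, M (x i)) ->
    exists n (l : 'I_n -> L), is_lin_basis (lin_span x) l /\ separated l.

End Setting.

Lemma phi_expansion (K : fieldType) (Phi f : {poly K}) : (1 < size Phi)%N ->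
  f = \sum_(i < size f) phi_coef Phi f i * Phi ^+ i.
Proof.
move=> sPhi.
have Phi0 : Phi != 0 by rewrite -size_poly_gt0 (ltn_trans _ sPhi).
have H n : f = \sum_(i < n) phi_coef Phi f i * Phi ^+ i
               + f %/ Phi ^+ n * Phi ^+ n.
  elim: n => [|n IH]; first by rewrite big_ord0 add0r expr0 divp1 mulr1.
  rewrite big_ord_recr /= {1}IH -addrA; congr (_ + _).
  rewrite exprSr -divp_divl -exprSr exprS mulrA -mulrDl addrC.
  by rewrite /phi_coef -divp_eq.
rewrite {1}(H (size f)) divp_small ?mul0r ?addr0 //.
rewrite [X in (_ < X)%N]polySpred ?expf_neq0 // ltnS size_exp leq_pmull //.
by rewrite -subn1 subn_gt0.
Qed.

(* Main.v *)
(* Call e the smallest degree of a monic Phi' with nu_Phi(Phi') < nu(Phi').  In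
   degrees < e, nu = nu_Phi.  The recursion
     nu_Phi(b + Phi f) = min(nu(b), nu(Phi) + nu_Phi(f)),  deg b < d,
   reduces the multiplicativity of nu_Phi to that of constant coefficients, where
   it is the key property of Phi.  Maximality of nu(Phi) gives e > d; comparing nu
   and nu_Phi on f g = q Phi' + r shows that Phi' is a key polynomial; and a key
   polynomial Psi = Phi A + B of degree in ]d, e[ would give
   nu(B) = nu(Phi A) < nu(Psi) = nu_Phi(Psi) <= nu(B).  Hence e = d'.

   For 3), the multiplication is that of the graded algebra of a valuation of K[X]
   which agrees with nu in degrees < d': nu itself if it is multiplicative on
   K(chi), and nu_Phi' otherwise.  A basis consists of the in(Phi^i), i d < d', and
   d divides d' because Phi' can be multiplied by an inverse modulo Phi of the
   leading coefficient of its Phi-expansion.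

   For 4), every nonzero x of a module with a separated basis has a coordinate phi
   such that phi(x) = 1 and nu(y) <= nu(phi(y)) + nu(x) for all y.  This property
   goes from K_{d-1}[chi] to K_{d'-1}[chi] because nu = nu_Phi there, and it is what
   Gaussian elimination needs to produce separated bases. *)
Require Import Defs.
From mathcomp Require Import all_boot all_order all_algebra.
From mathcomp Require Import boolp classical_sets cardinality.
From mathcomp Require Import zify.

Set Implicit Arguments.
Unset Strict Implicit.
Unset Printing Implicit Defensive.

Import Order.TTheory GRing.Theory Num.Theory.

Local Open Scope classical_set_scope.
Local Open Scope ring_scope.

(** When [chi] is algebraic, [nu] is multiplicative only on products of degree below [N], so no step
    may multiply freely: multiplicativity of [nu] carries a bound on the sum of the degrees
    ([mul_deg]). For [nu_Phi] the obstacle is milder. Its products reduce to products of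
    coefficients, of degree at most d - 1, so that [nu_Phi] is a valuation of the whole of K[X] as
    soon as 2 (d - 1) < N, even where [nu] is not multiplicative. This is why nu_Phi' can replace
    [nu] in 3), and why that part computes with polynomials rather than with elements of K[chi]. The
    minimal polynomial enters as a polynomial of infinite value. It always jumps, which bounds e by
    [N] and keeps the comparison of [nu] with [nu_Phi] in degrees where a nonzero polynomial has a
    finite value. *)

Record ordered_group := OrderedGroup {
  ordered_group_sort :> porderZmodType;
  ordered_groupP : linearly_ordered_group ordered_group_sort
}.

(** * Values with infinity, and ultrametric functions *)

Section Values.
Variable Gamma : ordered_group.
Let Gamma_ordered := ordered_groupP Gamma.
Implicit Types (a b c : option Gamma) (g h : Gamma).

Lemma lg_leD g x y : (g + x <= g + y) = (x <= y).
Proof.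
have mono := proj2 Gamma_ordered.
apply/idP/idP => [le_gx|]; last exact: mono.
by rewrite -(addKr g x) -(addKr g y); apply: mono.
Qed.

Lemma vle_refl a : vle a a.
Proof. by case: a => //= x; exact: lexx. Qed.

Lemma vle_trans b a c : vle a b -> vle b c -> vle a c.
Proof. by case: a b c => [x|] [y|] [z|] //=; exact: le_trans. Qed.

Lemma vle_anti a b : vle a b -> vle b a -> a = b.
Proof.
case: a b => [x|] [y|] //= le_xy le_yx.
by congr Some; apply/le_anti; rewrite le_xy le_yx.
Qed.

Lemma vle_total a b : vle a b || vle b a.
Proof. by case: a b => [x|] [y|] //=; exact: (proj1 Gamma_ordered). Qed.

Lemma vle_None a : vle a None.
Proof. by case: a. Qed.

Lemma vltNge a b : vlt a b = ~~ vle b a.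
Proof. by []. Qed.

Lemma vleNgt a b : vle a b = ~~ vlt b a.
Proof. by rewrite /vlt negbK. Qed.

Lemma vltW a b : vlt a b -> vle a b.
Proof. by rewrite /vlt => /negbTE ltab; have := vle_total a b; rewrite ltab orbF. Qed.

Lemma vltxx a : vlt a a = false.
Proof. by rewrite /vlt vle_refl. Qed.

Lemma vlt_le_trans b a c : vlt a b -> vle b c -> vlt a c.
Proof. by rewrite /vlt => /negP ltab lebc; apply/negP => leca; apply/ltab/(vle_trans lebc). Qed.

Lemma vle_lt_trans b a c : vle a b -> vlt b c -> vlt a c.
Proof. by rewrite /vlt => leab /negP ltbc; apply/negP => leca; apply/ltbc/(vle_trans leca). Qed.

Lemma vltNone a : vlt a None = (a != None).
Proof. by case: a. Qed.

Lemma vle_neqNone a b : vle a b -> b != None -> a != None.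
Proof. by case: a b => [x|] []. Qed.

Lemma vle_vmin a b c : vle a (vmin b c) = vle a b && vle a c.
Proof.
rewrite /vmin; case: ifP => lebc.
  by case leab: (vle a b) => //; rewrite (vle_trans leab lebc).
have lecb : vle c b by have := vle_total b c; rewrite lebc.
by case leac: (vle a c); rewrite ?andbF // (vle_trans leac lecb).
Qed.

Lemma vmin_vle a b c : vle (vmin a b) c = vle a c || vle b c.
Proof.
rewrite /vmin; case: ifP => leab.
  by case lebc: (vle b c); rewrite ?orbF // (vle_trans leab lebc).
have leba : vle b a by have := vle_total a b; rewrite leab.
by case leac: (vle a c) => //; rewrite (vle_trans leba leac).
Qed.

Lemma vlt_vmin a b c : vlt a (vmin b c) = vlt a b && vlt a c.
Proof. by rewrite /vlt vmin_vle negb_or. Qed.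

Lemma vmin_vlt a b c : vlt (vmin a b) c = vlt a c || vlt b c.
Proof. by rewrite /vlt vle_vmin negb_and. Qed.

Lemma vmin_l a b : vle a b -> vmin a b = a.
Proof. by rewrite /vmin => ->. Qed.

Lemma vmin_r a b : vle b a -> vmin a b = b.
Proof. by rewrite /vmin; case: ifP => // leab leba; exact: vle_anti. Qed.

Lemma vle_bigvmin (I : Type) (r : seq I) (P : pred I) (F : I -> option Gamma) a :
  (forall i, P i -> vle a (F i)) -> vle a (\big[@vmin Gamma/None]_(i <- r | P i) F i).
Proof.
by move=> leF; elim/big_ind: _ => //; [rewrite vle_None | move=> x y lex ley; rewrite vle_vmin lex].
Qed.

Lemma bigvmin_vle (n : nat) (F : 'I_n -> option Gamma) i :
  vle (\big[@vmin Gamma/None]_(i < n) F i) (F i).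
Proof.
elim: n F i => [|n IHn] F i; first by case: i.
rewrite big_ord_recl vmin_vle; case: (unliftP ord0 i) => [j ->|->]; last by rewrite vle_refl.
by rewrite IHn orbT.
Qed.

Lemma bigvmin_attained (n : nat) (F : 'I_n -> option Gamma) :
  let m := \big[@vmin Gamma/None]_(i < n) F i in
  m != None -> exists i, m = F i.
Proof.
elim: n F => [|n IHn] F /=; first by rewrite big_ord0.
rewrite big_ord_recl /= => H.
have [le0|le0] := boolP (vle (F ord0) (\big[@vmin Gamma/None]_(i < n) F (lift ord0 i))).
  by exists ord0; rewrite vmin_l.
rewrite vmin_r ?(vltW le0) // in H *.
by have [i ->] := IHn _ H; exists (lift ord0 i).
Qed.

Lemma vaddC a b : vadd a b = vadd b a.
Proof. by case: a b => [x|] [y|] //=; rewrite addrC. Qed.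

Lemma vaddA a b c : vadd a (vadd b c) = vadd (vadd a b) c.
Proof. by case: a b c => [x|] [y|] [z|] //=; rewrite addrA. Qed.

Lemma vaddCA a b c : vadd a (vadd b c) = vadd b (vadd a c).
Proof. by rewrite !vaddA (vaddC a). Qed.

Lemma vadd0 a : vadd a (Some 0) = a.
Proof. by case: a => //= x; rewrite addr0. Qed.

Lemma v0add a : vadd (Some 0) a = a.
Proof. by rewrite vaddC vadd0. Qed.

Lemma vaddNone a : vadd a None = None.
Proof. by case: a. Qed.

Lemma vadd_eqNone a b : (vadd a b == None) = (a == None) || (b == None).
Proof. by case: a b => [x|] [y|]. Qed.

Lemma vle_addl c a b : c != None -> vle (vadd c a) (vadd c b) = vle a b.
Proof. by case: c a b => [z|] [x|] [y|] //= _; exact: lg_leD. Qed.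

Lemma vle_addr c a b : c != None -> vle (vadd a c) (vadd b c) = vle a b.
Proof. by move=> c0; rewrite !(vaddC _ c) vle_addl. Qed.

Lemma vlt_addl c a b : c != None -> vlt (vadd c a) (vadd c b) = vlt a b.
Proof. by move=> c0; rewrite /vlt vle_addl. Qed.

Lemma vlt_addr c a b : c != None -> vlt (vadd a c) (vadd b c) = vlt a b.
Proof. by move=> c0; rewrite /vlt vle_addr. Qed.

Lemma vadd_injl c a b : c != None -> vadd c a = vadd c b -> a = b.
Proof. by move=> c0 e; apply: vle_anti; rewrite -(vle_addl _ _ c0) e vle_refl. Qed.

Lemma vle_add a b c e : vle a b -> vle c e -> vle (vadd a c) (vadd b e).
Proof.
move=> leab; have [->|e0] := eqVneq e None; first by rewrite vaddNone vle_None.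
have [->|b0] := eqVneq b None; first by rewrite vle_None.
move=> lece; apply: (@vle_trans (vadd b c)).
  by rewrite vle_addr // (vle_neqNone lece e0).
by rewrite vle_addl.
Qed.

Lemma vlt_le_add a b c e : c != None -> vlt a b -> vle c e -> vlt (vadd a c) (vadd b e).
Proof.
move=> c0 ltab lece; apply: (@vlt_le_trans (vadd b c)).
  by rewrite vlt_addr.
by apply: vle_add => //; exact: vle_refl.
Qed.

Lemma vle_lt_add a b c e : a != None -> vle a b -> vlt c e -> vlt (vadd a c) (vadd b e).
Proof. by move=> a0 leab ltce; rewrite (vaddC a) (vaddC b); exact: vlt_le_add. Qed.

Lemma vmuln0 a : a != None -> vmuln a 0 = Some 0.
Proof. by case: a => //= x; rewrite mulr0n. Qed.

Lemma vmulnS a n : vmuln a n.+1 = vadd a (vmuln a n).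
Proof. by case: a => //= x; rewrite mulrS. Qed.

Lemma vmuln_eqNone a n : (vmuln a n == None) = (a == None).
Proof. by case: a. Qed.

(** The value may be infinite away from 0: as a function of polynomials, [nu (ev f)] is infinite on
    the multiples of the minimal polynomial. *)
Definition ultrametric (V : zmodType) (n : V -> option Gamma) : Prop :=
  [/\ n 0 = None, forall x, n (- x) = n x
    & forall x y, vle (vmin (n x) (n y)) (n (x + y))].

Section Ultrametric.
Variables (V : zmodType) (n : V -> option Gamma) (nU : ultrametric n).

Lemma um0 : n 0 = None. Proof. by case: nU. Qed.

Lemma umN x : n (- x) = n x. Proof. by case: nU. Qed.

Lemma umBC x y : n (x - y) = n (y - x). Proof. by rewrite -umN opprB. Qed.

Lemma um_leD a x y : vle a (n x) -> vle a (n y) -> vle a (n (x + y)).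
Proof.
case: nU => _ _ nD lex ley; apply: vle_trans (nD x y).
by rewrite vle_vmin lex.
Qed.

Lemma um_ltD a x y : vlt a (n x) -> vlt a (n y) -> vlt a (n (x + y)).
Proof.
case: nU => _ _ nD lex ley; apply: vlt_le_trans (nD x y).
by rewrite vlt_vmin lex.
Qed.

Lemma um_leB a x y : vle a (n x) -> vle a (n y) -> vle a (n (x - y)).
Proof. by move=> lex ley; apply: um_leD; rewrite ?umN. Qed.

Lemma um_ltB a x y : vlt a (n x) -> vlt a (n y) -> vlt a (n (x - y)).
Proof. by move=> lex ley; apply: um_ltD; rewrite ?umN. Qed.

Lemma um_ltDl x y : vlt (n x) (n y) -> n (x + y) = n x.
Proof.
move=> ltxy; apply: vle_anti; last exact/um_leD/vltW/ltxy/vle_refl.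
rewrite vleNgt; apply/negP => lt.
by have := um_ltB lt ltxy; rewrite addrK vltxx.
Qed.

Lemma um_ltDr x y : vlt (n y) (n x) -> n (x + y) = n y.
Proof. by rewrite addrC; exact: um_ltDl. Qed.

Lemma um_near x y : vlt (n x) (n (x - y)) -> n y = n x.
Proof. by move=> lt; rewrite -[y](subKr x) um_ltDl ?umN. Qed.

Lemma um_lt_sum g (I : Type) (r : seq I) (P : pred I) (F : I -> V) :
  (forall i, P i -> vlt (Some g) (n (F i))) ->
  vlt (Some g) (n (\sum_(i <- r | P i) F i)).
Proof.
move=> leF; elim/big_ind: _ => //; first by rewrite um0.
by move=> x y; exact: um_ltD.
Qed.

End Ultrametric.

End Values.

(** * Evaluation at chi, and the degree of the extension *)

Section Evaluation.
Variables (K L : fieldType) (iota : {rmorphism K -> L}) (chi : L).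
Implicit Types p q f : {poly K}.
Local Notation ev := (ev iota chi).

Lemma ev0 : ev 0 = 0. Proof. by rewrite /ev rmorph0 horner0. Qed.

Lemma ev1 : ev 1 = 1. Proof. by rewrite /ev rmorph1 hornerC. Qed.

Lemma evN p : ev (- p) = - ev p. Proof. by rewrite /ev rmorphN hornerN. Qed.

Lemma evD p q : ev (p + q) = ev p + ev q. Proof. by rewrite /ev rmorphD hornerD. Qed.

Lemma evB p q : ev (p - q) = ev p - ev q. Proof. by rewrite evD evN. Qed.

Lemma evM p q : ev (p * q) = ev p * ev q. Proof. by rewrite /ev rmorphM hornerM. Qed.

Lemma evC a : ev a%:P = iota a. Proof. by rewrite /ev map_polyC hornerC. Qed.

Lemma evZ a p : ev (a *: p) = iota a * ev p.
Proof. by rewrite -mul_polyC evM evC. Qed.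

Lemma ev_wide n (p : {poly K}) : (size p <= n)%N ->
  ev p = lincomb iota (fun i : 'I_n => p`_i) (fun i => chi ^+ i).
Proof.
move=> sp; rewrite /ev (@horner_coef_wide _ n) ?(leq_trans (size_poly _ _)) //.
by apply: eq_bigr => i _; rewrite coef_map.
Qed.

Lemma lincomb_ev n (c : 'I_n -> K) :
  exists2 p : {poly K}, (size p <= n)%N /\ (forall i : 'I_n, p`_i = c i)
    & lincomb iota c (fun i => chi ^+ i) = ev p.
Proof.
pose f i := if insub i is Some j then c j else 0.
have fE (i : 'I_n) : f i = c i by rewrite /f valK.
exists (\poly_(i < n) f i); first by split=> [|i]; rewrite ?size_poly // coef_poly ltn_ord fE.
rewrite (ev_wide (size_poly _ _)); apply: eq_bigr => i _.
by rewrite coef_poly ltn_ord fE.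
Qed.

Lemma Kpoly_setT z : Kpoly iota chi None z <-> exists p, z = ev p.
Proof. by split=> [[p _ ->]|[p ->]]; exists p. Qed.

(** If [y] were longer than [x], its coordinate matrix would have more rows than columns; a nonzero
    row of the left kernel is a relation among the [y i]. *)
Lemma lin_free_leq m n (y : 'I_m -> L) (x : 'I_n -> L) :
  lin_free iota y -> (forall i, lin_span iota x (y i)) -> (m <= n)%N.
Proof.
move=> yF /choice[c yE]; rewrite leqNgt; apply/negP => ltnm.
pose C := \matrix_(i, j) c i j : 'M[K]_(m, n).
have : kermx C != 0.
  rewrite -mxrank_eq0 mxrank_ker -lt0n subn_gt0.
  by apply: leq_ltn_trans ltnm; exact: rank_leq_col.
case/rowV0Pn => r /sub_kermxP rC /negP[]; apply/eqP/rowP => i; rewrite mxE.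
apply: (yF (fun i => r 0 i)); rewrite /lincomb.
under eq_bigr => k _ do rewrite yE /lincomb mulr_sumr.
rewrite exchange_big big1 //= => j _.
transitivity (iota ((r *m C) 0 j) * x j); last by rewrite rC mxE rmorph0 mul0r.
rewrite mxE rmorph_sum mulr_suml; apply: eq_bigr => k _.
by rewrite mxE rmorphM mulrA.
Qed.

Lemma powers_free n :
  (forall p : {poly K}, (size p <= n)%N -> ev p = 0 -> p = 0) ->
  lin_free iota (fun i : 'I_n => chi ^+ i).
Proof.
move=> inj c; have [p [sp pE] ->] := lincomb_ev c.
by move=> /(inj _ sp) p0 i; rewrite -pE p0 coef0.
Qed.

Lemma lin_span_self n (x : 'I_n -> L) i : lin_span iota x (x i).
Proof.
exists (fun j => (j == i)%:R); rewrite /lincomb (bigD1 i) //= eqxx rmorph1 mul1r.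
by rewrite big1 ?addr0 // => j /negbTE ->; rewrite rmorph0 mul0r.
Qed.

Lemma minpoly_exists (p : {poly K}) : p != 0 -> ev p = 0 ->
  exists q, is_minpoly iota chi q.
Proof.
move=> p0 evp.
pose Z n := `[< exists2 q : {poly K}, q != 0 /\ ev q = 0 & size q = n >].
have exZ : exists n, Z n by exists (size p); apply/asboolP; exists p.
case: (ex_minnP exZ) => n /asboolP[q [q0 evq] sq] minn.
have lq : lead_coef q != 0 by rewrite lead_coef_eq0.
exists ((lead_coef q)^-1 *: q); split.
- by rewrite monicE lead_coefZ mulVf.
- by rewrite evZ evq mulr0.
move=> f evf; rewrite dvdpZl ?invr_eq0 //; apply/modp_eq0P/eqP/negPn/negP => r0.
suff : (n <= size (f %% q)%R)%N by rewrite leqNgt -sq ltn_modp q0.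
apply: minn; apply/asboolP; exists (f %% q) => //; split => //.
have := evf; rewrite {1}(divp_eq f q) evD evM evq mulr0 add0r //.
Qed.

Lemma minpoly_small q f : is_minpoly iota chi q -> (size f < size q)%N -> ev f = 0 -> f = 0.
Proof.
move=> [_ _ dvq] sf /dvq dvf; apply/eqP/negPn/negP => f0.
by have := dvdp_leq f0 dvf; rewrite leqNgt sf.
Qed.

Lemma minpoly_basis q : is_minpoly iota chi q ->
  is_lin_basis iota (Kpoly iota chi None) (fun i : 'I_(size q).-1 => chi ^+ i).
Proof.
move=> qmin; have [mon evq _] := qmin.
have sq : (size q).-1.+1 = size q by rewrite prednK // size_poly_gt0 monic_neq0.
split; first by apply: powers_free => p sp; apply: (minpoly_small qmin); rewrite -sq.
apply/seteqP; split => z; last first.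
  move=> /Kpoly_setT[p ->]; exists (fun i => (p %% q)`_i).
  rewrite -ev_wide; last by rewrite -ltnS sq ltn_modp monic_neq0.
  by rewrite {1}(divp_eq p q) evD evM evq mulr0 add0r.
by move=> [c ->]; have [p _ ->] := lincomb_ev c; apply/Kpoly_setT; exists p.
Qed.

(** If no nonzero polynomial vanished at [chi], the first n + 1 powers of [chi] would be free in a
    span of n vectors. Otherwise the powers below the degree of the minimal polynomial form a second
    basis, of the same length n. *)
Lemma ext_degreeP N : ext_degree iota chi N ->
  if N is Some n then exists2 q, is_minpoly iota chi q & size q = n.+1
  else forall p, ev p = 0 -> p = 0.
Proof.
case: N => [n|] /=.
  move=> [x [xF xS]]; have [[p [p0 evp]]|inj] := pselect (exists p, p != 0 /\ ev p = 0).
    have [q qmin] := minpoly_exists p0 evp; exists q => //.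
    have [qF qS] := minpoly_basis qmin; have [mon _ _] := qmin.
    have sq : (0 < size q)%N by rewrite size_poly_gt0 monic_neq0.
    rewrite -(prednK sq); congr _.+1.
    apply/eqP; rewrite eqn_leq; apply/andP; split.
      apply: (lin_free_leq (x := x) qF) => i; rewrite xS; apply/Kpoly_setT.
      by exists ('X ^+ i); rewrite /ev map_polyXn hornerXn.
    apply: (lin_free_leq (x := fun i => chi ^+ i) xF) => i; rewrite qS -xS.
    exact: lin_span_self.
  suff : (n.+1 <= n)%N by rewrite ltnn.
  apply: (@lin_free_leq _ _ (fun i : 'I_n.+1 => chi ^+ i) x).
    apply: powers_free => p _ evp; apply/eqP/negPn/negP => p0.
    by apply: inj; exists p.
  move=> i; rewrite xS; apply/Kpoly_setT.
  by exists ('X ^+ i); rewrite /ev map_polyXn hornerXn.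
move=> nobasis p evp; apply/eqP/negPn/negP => p0.
have [q /minpoly_basis qB] := minpoly_exists p0 evp.
exact: nobasis qB.
Qed.

Lemma minpoly_size_eq p q : is_minpoly iota chi p -> is_minpoly iota chi q -> size p = size q.
Proof.
move=> [pm evp dvp] [qm evq dvq]; apply/eqP; rewrite eqn_leq.
by rewrite !dvdp_leq ?monic_neq0 ?dvp ?dvq.
Qed.

(** A denominator [b] is coprime to [q]: the gcd does not vanish at [chi], so its cofactor in [q]
    does and is a multiple of [q], which leaves a constant gcd. A Bezout coefficient then evaluates
    to the inverse of [ev b]. *)
Lemma generated_algebraic q : generated_by_chi iota chi -> is_minpoly iota chi q ->
  forall z, exists p, z = ev p.
Proof.
move=> gen qmin z; have [a [b [evb ->]]] := gen z; have [mon evq dvq] := qmin.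
have /Bezout_eq1_coprimepP[[u w] /= uw] : coprimep b q.
  rewrite /coprimep; set g := gcdp b q.
  have gb : g %| b by rewrite dvdp_gcdl.
  have gq : g %| q by rewrite dvdp_gcdr.
  have g0 : g != 0 by rewrite gcdp_eq0 negb_and (monic_neq0 mon) orbT.
  have evg : ev g != 0.
    by apply: contra_neq evb => evg; rewrite -(divpK gb) evM evg mulr0.
  have := divpK gq; set h := _ %/ _ => hg.
  have evh : ev h = 0.
    by apply/eqP; have := evq; rewrite -hg evM => /eqP; rewrite mulf_eq0 (negPf evg) orbF.
  have h0 : h != 0 by apply: contra_neq (monic_neq0 mon) => h0; rewrite -hg h0 mul0r.
  have := dvdp_leq h0 (dvq _ evh); rewrite -hg size_mul // -[X in (_ <= X)%N]addn0.
  have : (0 < size g)%N by rewrite size_poly_gt0.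
  by case: (size g) => // k _; rewrite addnS /= leq_add2l leqn0 => /eqP ->.
exists (a * u); rewrite evM; congr (_ * _); apply: (mulIf evb).
by rewrite mulVf // -evM -ev1 -uw evD !evM evq mulr0 addr0.
Qed.

End Evaluation.

Lemma ltn_ext_le m n N : (m <= n)%N -> ltn_ext n N -> ltn_ext m N.
Proof. by case: N => //= k; exact: leq_ltn_trans. Qed.

Definition monic_below (K : fieldType) (N : option nat) (Phi : {poly K}) d : Prop :=
  [/\ Phi \is monic, size Phi = d.+1, (0 < d)%N & ltn_ext d N].

(** * Properties of nu common to the algebraic and the transcendental case *)

Section Facts.
Variables (K L : fieldType) (iota : {rmorphism K -> L}) (chi : L) (N : option nat).
Variables (Gamma : ordered_group) (nu : L -> option Gamma).
Local Notation ev := (ev iota chi).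
Local Notation v p := (nu (ev p)).
Implicit Types b c p q f g : {poly K}.

(* nu is multiplicative on the products of two polynomials whose degrees add up
   to n. *)
Definition mul_deg (n : nat) : Prop := ltn_ext n N \/ field_valuation nu.

Record pm_facts : Prop := PmFacts {
  nuU : ultrametric nu;
  nu_inj : forall y, nu y = None -> y = 0;
  nu1 : nu 1 = Some 0;
  v_scale : forall a f, v (a *: f) = vadd (nu (iota a)) (v f);
  ev_inj : forall f, ltn_ext (size f).-1 N -> ev f = 0 -> f = 0;
  v_mul : forall f g, mul_deg ((size f).-1 + (size g).-1) -> v (f * g) = vadd (v f) (v g)
}.

Lemma vadd_self (a : option Gamma) : a != None -> vadd a a = a -> a = Some 0.
Proof. by move=> a0 aa; apply: (vadd_injl a0); rewrite aa vadd0. Qed.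

(** A linearly ordered group has no 2-torsion. Since -1 squares to 1, this gives -1 the value 0,
    hence [nu (- x) = nu x]. *)
Lemma vadd_self0 (a : option Gamma) : vadd a a = Some 0 -> a = Some 0.
Proof.
case: a => //= x [xx]; congr Some.
have mono := proj2 (ordered_groupP Gamma).
have /orP[le0|ge0] := proj1 (ordered_groupP Gamma) x 0; apply/le_anti; rewrite ?le0 ?ge0 ?andbT /=.
  by have := mono x _ _ le0; rewrite xx addr0.
by have := mono x _ _ ge0; rewrite xx addr0.
Qed.

(** In the algebraic case K[chi] is all of [L], so the axioms of a module valuation hold everywhere;
    in the transcendental case [nu] is a field valuation by definition. *)
Lemma pm_factsP : generated_by_chi iota chi -> ext_degree iota chi N ->
  pm_valuation iota chi N nu -> pm_facts.
Proof.
move=> gen /ext_degreeP degN [[nuK0 nuKD nuKM] vM tr].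
have M1 : Kpoly iota chi None 1 by exists 1 => //; rewrite ev1.
have evI f : ltn_ext (size f).-1 N -> ev f = 0 -> f = 0.
  case: N degN {vM tr} => [n|] /= dN; last by move=> _; exact: dN.
  have [q qm sq] := dN; move=> sf; apply: (minpoly_small qm).
  by rewrite sq ltnS; case: (size f) sf => //.
have n1 : nu 1 = Some 0.
  apply: vadd_self; first by apply/eqP => /(nuK0 _ M1)/eqP; rewrite oner_eq0.
  by have := nuKM 1 1 M1; rewrite rmorph1 mulr1 => <-.
have Mi a : Kpoly iota chi None (iota a) by exists a%:P => //; rewrite evC.
have nN1 : nu (iota (-1)) = Some 0.
  by apply: vadd_self0; rewrite -(nuKM _ _ (Mi _)) rmorphN1 mulrNN mul1r.
have [/eqP trans|alg] := boolP (N == None); last first.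
  have allM z : Kpoly iota chi None z.
    case: N alg degN => [n|] //= _ [q qm _]; have [p ->] := generated_algebraic gen qm z.
    by exists p.
  split => //.
  - split=> [|x|x y]; first exact/nuK0.
      by rewrite -mulN1r -(rmorphN1 iota) nuKM // nN1 v0add.
    exact: nuKD.
  - by move=> y /nuK0; exact.
  - by move=> a f; rewrite evZ nuKM.
  - move=> f g []; first exact: vM.
    by case=> _ _ nM; rewrite evM nM.
have fv := tr trans; have [f0 fD fM] := fv.
split => //.
- split=> [|x|x y]; first exact/f0.
    by rewrite -mulN1r -(rmorphN1 iota) fM nN1 v0add.
  exact: fD.
- by move=> y /f0.
- by move=> a f; rewrite evZ fM.
- by move=> f g _; rewrite evM fM.
Qed.

Hypothesis F : pm_facts.

Lemma v_ultra : ultrametric (fun f => v f).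
Proof.
have [n0 nN nD] := nuU F.
by split=> [|f|f g]; rewrite ?ev0 // ?evN // evD.
Qed.

Lemma v_neqNone f : ltn_ext (size f).-1 N -> f != 0 -> v f != None.
Proof.
move=> sf f0; apply/eqP => /(nu_inj F) /(ev_inj F sf) /eqP.
by rewrite (negPf f0).
Qed.

Lemma v_1 : v 1 = Some 0. Proof. by rewrite ev1 nu1. Qed.

Lemma mul_deg_le m n : (m <= n)%N -> mul_deg n -> mul_deg m.
Proof. by move=> le_mn [/(ltn_ext_le le_mn)|]; [left|right]. Qed.

(** * Phi-expansions and nu_Phi, for a monic Phi of degree d *)

Section PhiExpansion.
Variables (Phi : {poly K}) (d : nat).
Hypothesis PhiH : monic_below N Phi d.
Local Notation nF := (nu_Phi iota chi nu Phi).
Local Notation gam := (v Phi).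

Let Phi_monic : Phi \is monic. Proof. by case: PhiH. Qed.
Let Phi_size : size Phi = d.+1. Proof. by case: PhiH. Qed.
Let d_gt0 : (0 < d)%N. Proof. by case: PhiH. Qed.
Let d_lt : ltn_ext d N. Proof. by case: PhiH. Qed.
Let Phi0 : Phi != 0. Proof. exact: monic_neq0. Qed.

Lemma size_PhiX i : size (Phi ^+ i) = (i * d).+1.
Proof.
have : (0 < size (Phi ^+ i))%N by rewrite size_poly_gt0 expf_neq0.
by move/prednK <-; rewrite size_exp Phi_size mulnC.
Qed.

Lemma size_modPhi f : (size (f %% Phi)%R <= d)%N.
Proof. by rewrite -ltnS -Phi_size ltn_modp. Qed.

Lemma size_divPhi f : size (f %/ Phi)%R = (size f - d)%N.
Proof. by rewrite size_divp // Phi_size. Qed.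

Lemma modPhi_small b f : (size b <= d)%N -> (b + Phi * f) %% Phi = b.
Proof. by move=> sb; rewrite mulrC addrC modp_addl_mul_small // Phi_size ltnS. Qed.

Lemma divPhi_small b f : (size b <= d)%N -> (b + Phi * f) %/ Phi = f.
Proof. by move=> sb; rewrite mulrC addrC divp_addl_mul_small // Phi_size ltnS. Qed.

Lemma Phi_eq f : f = f %% Phi + Phi * (f %/ Phi).
Proof. by rewrite {1}(divp_eq f Phi) addrC mulrC. Qed.

Lemma phi_coef0 f : phi_coef Phi f 0 = f %% Phi.
Proof. by rewrite /phi_coef expr0 divp1. Qed.

Lemma phi_coefS f i : phi_coef Phi f i.+1 = phi_coef Phi (f %/ Phi) i.
Proof. by rewrite /phi_coef exprS divp_divl. Qed.

Lemma phi_coefD f g i : phi_coef Phi (f + g) i = phi_coef Phi f i + phi_coef Phi g i.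
Proof. by rewrite /phi_coef divpD modpD. Qed.

Lemma phi_coefN f i : phi_coef Phi (- f) i = - phi_coef Phi f i.
Proof. by rewrite /phi_coef divpN modpN. Qed.

Lemma phi_coefZ a f i : phi_coef Phi (a *: f) i = a *: phi_coef Phi f i.
Proof. by rewrite /phi_coef divpZl modpZl. Qed.

Lemma phi_coef_small f i : (size f <= i * d)%N -> phi_coef Phi f i = 0.
Proof.
elim: i f => [|i IHi] f sf.
  by rewrite phi_coef0; move: sf; rewrite leqn0 size_poly_eq0 => /eqP ->; rewrite mod0p.
by rewrite phi_coefS IHi // size_divPhi leq_subLR.
Qed.

Lemma size_phi_coef f i : (size (phi_coef Phi f i) <= d)%N.
Proof. exact: size_modPhi. Qed.

Lemma phi_coef_mulX c k j : (size c <= d)%N ->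
  phi_coef Phi (c * Phi ^+ k) j = if j == k then c else 0.
Proof.
move=> sc; elim: k j => [|k IHk] [|j]; rewrite ?expr0 ?mulr1 ?phi_coef0 ?phi_coefS.
- by rewrite modp_small // Phi_size ltnS.
- by rewrite divp_small ?Phi_size // phi_coef_small // size_poly0.
- by rewrite exprSr mulrA modp_mull.
- by rewrite exprSr mulrA mulpK // IHk eqSS.
Qed.

Lemma phi_expansion_wide m f : (size f <= m * d)%N ->
  f = \sum_(i < m) phi_coef Phi f i * Phi ^+ i.
Proof.
elim: m f => [|m IHm] f sf.
  by rewrite big_ord0; apply/eqP; rewrite -size_poly_leq0.
rewrite big_ord_recl phi_coef0 expr0 mulr1 {1}(Phi_eq f) {1}(IHm (f %/ Phi)); last first.
  by rewrite size_divPhi leq_subLR.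
rewrite mulr_sumr; congr (_ + _); apply: eq_bigr => i _.
by rewrite phi_coefS mulrCA -exprS.
Qed.

Lemma gam_neqNone : gam != None.
Proof. by apply: v_neqNone => //; rewrite Phi_size. Qed.

(** The truncation of the minimum at [size f] disappears: as d > 0, the later coefficients are 0 and
    have infinite value. *)
Lemma nuPhi_leP (x : option Gamma) f :
  vle x (nF f) <-> forall i, vle x (vadd (v (phi_coef Phi f i)) (vmuln gam i)).
Proof.
split=> [lec i|lec]; last by apply: vle_bigvmin.
have [si|si] := ltnP i (size f); last first.
  rewrite phi_coef_small ?ev0 ?(um0 (nuU F)) ?vle_None //.
  by apply: leq_trans si _; rewrite leq_pmulr.
by apply: vle_trans lec _; apply: (bigvmin_vle _ (Ordinal si)).
Qed.

Lemma nuPhi_att f : nF f != None ->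
  exists i, nF f = vadd (v (phi_coef Phi f i)) (vmuln gam i).
Proof. by move=> /bigvmin_attained[i e]; exists i; exact: e. Qed.

Lemma nuPhi_le_coef f i : vle (nF f) (vadd (v (phi_coef Phi f i)) (vmuln gam i)).
Proof. by have /nuPhi_leP := vle_refl (nF f). Qed.

Lemma nuPhi_rec f : nF f = vmin (v (f %% Phi)) (vadd gam (nF (f %/ Phi))).
Proof.
apply: vle_anti.
  rewrite vle_vmin; apply/andP; split.
    by have := nuPhi_le_coef f 0; rewrite phi_coef0 vmuln0 ?gam_neqNone // vadd0.
  have [->|/nuPhi_att[i ->]] := eqVneq (nF (f %/ Phi)) None; first by rewrite vaddNone vle_None.
  by have := nuPhi_le_coef f i.+1; rewrite phi_coefS vmulnS vaddCA.
apply/nuPhi_leP => -[|i]; rewrite vmin_vle; apply/orP.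
  by left; rewrite phi_coef0 vmuln0 ?gam_neqNone // vadd0 vle_refl.
right; rewrite phi_coefS vmulnS vaddCA; apply: vle_add => //; first exact: vle_refl.
exact: nuPhi_le_coef.
Qed.

Lemma nuPhi_cons b f : (size b <= d)%N -> nF (b + Phi * f) = vmin (v b) (vadd gam (nF f)).
Proof. by move=> sb; rewrite nuPhi_rec modPhi_small ?divPhi_small. Qed.

Lemma nuPhi0 : nF 0 = None.
Proof. by rewrite /nu_Phi size_poly0 big_ord0. Qed.

Lemma nuPhi_small f : (size f <= d)%N -> nF f = v f.
Proof. by move=> sf; have := nuPhi_cons 0 sf; rewrite mulr0 addr0 nuPhi0 vaddNone vmin_l ?vle_None. Qed.

Lemma nuPhi_ultra : ultrametric nF.
Proof.
have vlN f g : vle (vmin (nF f) (nF g)) (nF (f + g)).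
  apply/nuPhi_leP => i; rewrite phi_coefD.
  rewrite vmin_vle; apply/orP.
  have /orP[l|l] := vle_total (v (phi_coef Phi f i)) (v (phi_coef Phi g i)).
    left; apply: vle_trans (nuPhi_le_coef f i) _; apply: vle_add => //; last exact: vle_refl.
    by apply: (um_leD v_ultra) => //; exact: vle_refl.
  right; apply: vle_trans (nuPhi_le_coef g i) _; apply: vle_add => //; last exact: vle_refl.
  by apply: (um_leD v_ultra) => //; exact: vle_refl.
split => //; first exact: nuPhi0.
have leN f : vle (nF f) (nF (- f)).
  by apply/nuPhi_leP => i; rewrite phi_coefN (umN v_ultra); exact: nuPhi_le_coef.
by move=> f; apply: vle_anti => //; have := leN (- f); rewrite opprK.
Qed.

Lemma nuPhi_mulPhi f : nF (Phi * f) = vadd gam (nF f).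
Proof.
have s0 : (size (0%R : {poly K}) <= d)%N by rewrite size_poly0.
have := nuPhi_cons f s0.
by rewrite add0r ev0 (um0 (nuU F)) vmin_r ?vle_None.
Qed.

Lemma nuPhi_mulXPhi i f : nF (Phi ^+ i * f) = vadd (vmuln gam i) (nF f).
Proof.
elim: i => [|i IHi]; first by rewrite expr0 mul1r vmuln0 ?gam_neqNone // v0add.
by rewrite exprS -mulrA nuPhi_mulPhi IHi vmulnS vaddA.
Qed.

Lemma nuPhi_neqNone f : f != 0 -> nF f != None.
Proof.
elim/ltn_ind: {f}(size f) {-2}f (erefl (size f)) => n IHn f sf f0.
rewrite nuPhi_rec; have [r0|r0] := eqVneq (f %% Phi) 0.
  have q0 : f %/ Phi != 0.
    by apply: contra_neq f0 => q0; rewrite (Phi_eq f) r0 q0 mulr0 addr0.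
  rewrite r0 ev0 (um0 (nuU F)) vmin_r ?vle_None // vadd_eqNone.
  rewrite negb_or gam_neqNone; apply: (IHn _ _ _ erefl q0).
  by rewrite size_divPhi -sf ltn_subrL d_gt0 size_poly_gt0 f0.
have vr : v (f %% Phi) != None.
  apply: v_neqNone => //; apply: ltn_ext_le d_lt.
  by apply: leq_trans (leq_pred _) (size_modPhi f).
apply: vle_neqNone vr; rewrite vmin_vle vle_refl //.
Qed.

(** This is the ultrametric inequality along the expansion; the degree bound makes [nu]
    multiplicative on each product [Phi * q] that occurs. *)
Lemma nuPhi_le_v f : mul_deg (size f).-1 -> vle (nF f) (v f).
Proof.
elim/ltn_ind: {f}(size f) {-2}f (erefl (size f)) => n IHn f sf ok.
have [sd|sd] := leqP (size f) d; first by rewrite nuPhi_small ?vle_refl.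
rewrite nuPhi_rec {3}(Phi_eq f).
set q := f %/ Phi; have sq : size q = (n - d)%N by rewrite size_divPhi sf.
have vq : v (Phi * q) = vadd gam (v q).
  apply: v_mul => //; apply: mul_deg_le ok; rewrite Phi_size sq -sf /=.
  rewrite -subn1 -[X in (_ <= X)%N]subn1 -subnDA [(d + 1)%N]addnC subnDA.
  by rewrite addnBCA ?subnn ?addn0 // leq_subRL // ?(leq_trans _ sd) // addnC addn1.
have leq : vle (nF q) (v q).
  apply: (IHn _ _ q erefl); rewrite ?sq.
    by rewrite ltn_subrL d_gt0 -sf (leq_trans _ sd).
  by apply: mul_deg_le ok; rewrite -sf -!subn1; apply: leq_sub2r; exact: leq_subr.
apply: (um_leD v_ultra); rewrite vmin_vle.
  by rewrite vle_refl.
by rewrite vq vle_add ?orbT ?vle_refl.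
Qed.

Lemma nuPhi_scale a f : nF (a *: f) = vadd (nu (iota a)) (nF f).
Proof.
have le (b : K) g : vle (vadd (nu (iota b)) (nF g)) (nF (b *: g)).
  apply/nuPhi_leP => i; rewrite phi_coefZ (v_scale F) -vaddA.
  by apply: vle_add => //; [exact: vle_refl|exact: nuPhi_le_coef].
have [->|a0] := eqVneq a 0; first by rewrite scale0r nuPhi0 rmorph0 (um0 (nuU F)).
apply: vle_anti => //.
(* The converse inequality is [le] for the inverse scalar. *)
have := le a^-1 (a *: f); rewrite scalerA mulVf // scale1r.
have aa : vadd (nu (iota a)) (nu (iota a^-1)) = Some 0.
  by have := v_scale F a a^-1%:P; rewrite -mul_polyC -rmorphM mulfV // v_1 evC.
move=> l; rewrite -[X in vle X _]v0add -aa -vaddA; apply: vle_add => //; exact: vle_refl.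
Qed.

End PhiExpansion.
End Facts.

(** * Degree condition for products under nu_Phi *)

Section KeyMulDeg.
Variables (K : fieldType) (N : option nat) (d : nat).
Implicit Types f g p q : {poly K}.

(* The coefficients of the Phi-expansions of f and g have degree at most
   min (deg f) (d - 1) and min (deg g) (d - 1), and the key property applies to
   their products: this is what makes nu_Phi multiplicative on f and g. *)
Definition key_mul_deg f g : Prop :=
  ltn_ext (minn (size f).-1 d.-1 + minn (size g).-1 d.-1) N.

Lemma key_mul_deg_le f g p q : (size p <= size f)%N -> (size q <= size g)%N ->
  key_mul_deg f g -> key_mul_deg p q.
Proof. by move=> sp sq; apply: ltn_ext_le; lia. Qed.

Lemma key_mul_deg_of f g : ltn_ext ((size f).-1 + (size g).-1) N -> key_mul_deg f g.
Proof. by apply: ltn_ext_le; lia. Qed.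

Lemma key_mul_deg_all f g : ltn_ext (d.-1 + d.-1) N -> key_mul_deg f g.
Proof. by apply: ltn_ext_le; lia. Qed.

Lemma key_mul_degC f g : key_mul_deg f g -> key_mul_deg g f.
Proof. by rewrite /key_mul_deg addnC. Qed.

End KeyMulDeg.

(** * Multiplicativity of nu_Phi for a key polynomial Phi *)

Section KeyPolynomials.
Variables (K L : fieldType) (iota : {rmorphism K -> L}) (chi : L) (N : option nat).
Variables (Gamma : ordered_group) (nu : L -> option Gamma).
Local Notation ev := (ev iota chi).
Local Notation v p := (nu (ev p)).
Implicit Types a b c f g p q : {poly K}.
Hypothesis F : pm_facts iota chi N nu.
Variables (Phi : {poly K}) (d : nat).
Hypothesis Phi_key : key_poly iota chi N nu d Phi.
Local Notation nF := (nu_Phi iota chi nu Phi).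
Local Notation gam := (v Phi).

Let PhiH : monic_below N Phi d. Proof. by case: Phi_key => ? ? []. Qed.
Let Phi_size : size Phi = d.+1. Proof. by case: Phi_key. Qed.
Let d_gt0 : (0 < d)%N. Proof. by case: Phi_key => _ _ []. Qed.
Let d_lt : ltn_ext d N. Proof. by case: Phi_key => _ _ []. Qed.
Let Phi0 : Phi != 0. Proof. by case: PhiH => /monic_neq0. Qed.
Let nF_ultra := nuPhi_ultra F PhiH.

Lemma size_Phi_cons b f : (size b <= d)%N -> f != 0 -> size (b + Phi * f) = (d + size f)%N.
Proof.
move=> sb f0; have sPf : size (Phi * f) = (d + size f)%N by rewrite size_mul // Phi_size.
rewrite addrC size_polyDl sPf // (leq_ltn_trans sb) // -[X in (X < _)%N]addn0.
by rewrite ltn_add2l size_poly_gt0.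
Qed.

Lemma small_neqNone a : (size a <= d)%N -> a != 0 -> v a != None.
Proof.
move=> sa; apply: (v_neqNone F); apply: ltn_ext_le d_lt.
exact: leq_trans (leq_pred _) sa.
Qed.

(** The key property bounds the value of [q * Phi], where q is the quotient. As deg q + d <= deg a +
    deg b < N when q is nonzero, and deg q < d, this value is [vadd gam (nF q)], so the inequality
    becomes one on [nu_Phi]. *)
Lemma nuPhi_key a b : (size a <= d)%N -> (size b <= d)%N ->
    ltn_ext ((size a).-1 + (size b).-1) N -> a != 0 -> b != 0 ->
  [/\ nF (a * b) = vadd (v a) (v b),
      v ((a * b) %% Phi) = vadd (v a) (v b)
    & vlt (vadd (v a) (v b)) (vadd gam (nF ((a * b) %/ Phi)))].
Proof.
move=> sa sb ok a0 b0.
have [_ _ _ keyP] := Phi_key; have [e lt] := keyP a b a0 b0 sa sb ok.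
have vab : v (a * b) = vadd (v a) (v b) by apply: (v_mul F); left.
suff strict : vlt (vadd (v a) (v b)) (vadd gam (nF ((a * b) %/ Phi))).
  split=> //; last by rewrite -e.
  by rewrite (nuPhi_rec F PhiH) -e vab vmin_l // vltW.
set q := _ %/ _ in lt *; have sq : size q = ((size a + size b).-1 - d)%N.
  by rewrite (size_divPhi PhiH) size_mul.
have ab0 : vadd (v a) (v b) != None.
  by rewrite vadd_eqNone negb_or !small_neqNone.
have [q0|q0] := eqVneq q 0; first by rewrite q0 (nuPhi0 iota chi nu) vaddNone vltNone.
have sq0 : (0 < size q)%N by rewrite size_poly_gt0.
have sap : (0 < size a)%N by rewrite size_poly_gt0.
have sbp : (0 < size b)%N by rewrite size_poly_gt0.
have sqd : (size q <= d)%N.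
  by rewrite sq leq_subLR; apply: leq_trans (leq_pred _) _; exact: leq_add.
suff vq : v (q * Phi) = vadd gam (v q) by rewrite (nuPhi_small F PhiH) // -vq -vab e.
rewrite vaddC; apply: (v_mul F); left; apply: ltn_ext_le ok; rewrite Phi_size.
by move: sq0 sap sbp; rewrite sq; move: (size a) (size b) => m n; clear; lia.
Qed.

Lemma nuPhi_key_mul a b : (size a <= d)%N -> (size b <= d)%N ->
  ltn_ext ((size a).-1 + (size b).-1) N -> nF (a * b) = vadd (v a) (v b).
Proof.
move=> sa sb ok.
have [->|a0] := eqVneq a 0; first by rewrite mul0r (nuPhi0 iota chi nu) ev0 (um0 (nuU F)).
have [->|b0] := eqVneq b 0.
  by rewrite mulr0 (nuPhi0 iota chi nu) ev0 (um0 (nuU F)) vaddNone.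
by case: (nuPhi_key sa sb ok a0 b0).
Qed.

(** Induction on the length of the Phi-expansion. The two size conditions let [key_mul_deg] pass
    from [b + Phi * f] to [b] and [f]. *)
Lemma Phi_ind (P : {poly K} -> Prop) :
  (forall b, (size b <= d)%N -> P b) ->
  (forall b f, (size b <= d)%N -> (size f < size (b + Phi * f)%R)%N ->
    (size b <= size (b + Phi * f)%R)%N -> P f -> P (b + Phi * f)) ->
  forall f, P f.
Proof.
move=> P0 PS f; elim/ltn_ind: {f}(size f) {-2}f (erefl (size f)) => n IHn f sf.
have sb := size_modPhi PhiH f.
rewrite (Phi_eq Phi f); have [->|q0] := eqVneq (f %/ Phi) 0.
  by rewrite mulr0 addr0; exact: P0.
have sq := size_Phi_cons sb q0; have sq0 : (0 < size (f %/ Phi)%R)%N by rewrite size_poly_gt0.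
apply: PS; rewrite ?sq //; [by rewrite -[X in (X < _)%N]add0n ltn_add2r|exact: leq_trans sb (leq_addr _ _)|].
apply: (IHn (size (f %/ Phi)%R)) => //.
by rewrite -sf [X in (_ < size (polyseq X))%N](Phi_eq Phi f) sq -[X in (X < _)%N]add0n ltn_add2r.
Qed.

Lemma nuPhi_mul_small_ge a g : (size a <= d)%N -> key_mul_deg N d a g ->
  vle (vadd (v a) (nF g)) (nF (a * g)).
Proof.
move=> sa; elim/Phi_ind: g => [b sb|b g sb sg sbg IHg] ok.
  rewrite (nuPhi_small F PhiH sb).
  rewrite nuPhi_key_mul //; first exact: vle_refl.
  by apply: ltn_ext_le ok; lia.
rewrite mulrDr mulrCA (nuPhi_cons F PhiH) //.
have ab : nF (a * b) = vadd (v a) (v b) by apply: nuPhi_key_mul => //; apply: ltn_ext_le ok; lia.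
apply: (um_leD nF_ultra).
  by rewrite ab; apply: vle_add; [exact: vle_refl|rewrite vmin_vle vle_refl].
rewrite (nuPhi_mulPhi F PhiH) //.
apply: (@vle_trans _ (vadd gam (vadd (v a) (nF g)))).
  by rewrite vaddCA; apply: vle_add; [exact: vle_refl|rewrite vmin_vle vle_refl orbT].
apply: vle_add; first exact: vle_refl.
by apply: IHg; apply: key_mul_deg_le ok => //; exact: ltnW.
Qed.

Lemma nuPhi_mul_ge f g : key_mul_deg N d f g -> vle (vadd (nF f) (nF g)) (nF (f * g)).
Proof.
elim/Phi_ind: f => [a sa|a f sa sf saf IHf] ok.
  by rewrite (nuPhi_small F PhiH sa); exact: nuPhi_mul_small_ge.
rewrite mulrDl -mulrA (nuPhi_cons F PhiH) //.
apply: (um_leD nF_ultra).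
  apply: (@vle_trans _ (vadd (v a) (nF g))).
    by apply: vle_add; [rewrite vmin_vle vle_refl|exact: vle_refl].
  by apply: nuPhi_mul_small_ge => //; apply: key_mul_deg_le ok.
rewrite (nuPhi_mulPhi F PhiH) //.
apply: (@vle_trans _ (vadd (vadd gam (nF f)) (nF g))).
  by apply: vle_add; [rewrite vmin_vle vle_refl orbT|exact: vle_refl].
rewrite -vaddA; apply: vle_add; first exact: vle_refl.
by apply: IHf; apply: key_mul_deg_le ok => //; exact: ltnW.
Qed.

(* A constant coefficient of f or g whose value exceeds nu_Phi can be dropped; if
   there is none, the constant coefficient of f g attains the minimum. *)
Lemma nuPhi_mul f g : key_mul_deg N d f g -> nF (f * g) = vadd (nF f) (nF g).
Proof.
have [n] := ubnP (size f + size g)%N; elim: n f g => // n IHn f g.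
have [->|f0] := eqVneq f 0; first by rewrite mul0r (nuPhi0 iota chi nu).
have [->|g0] := eqVneq g 0; first by rewrite mulr0 (nuPhi0 iota chi nu) vaddNone.
have nuPhi0 h : h != 0 -> nF h != None by move=> h0; exact: (nuPhi_neqNone F PhiH h0).
have size_div h : h != 0 -> (size (h %/ Phi)%R < size h)%N.
  by move=> h0; rewrite (size_divPhi PhiH) ltn_subrL d_gt0 size_poly_gt0.
have drop h k : h != 0 -> k != 0 -> key_mul_deg N d h k -> vlt (nF h) (v (h %% Phi)) ->
    (nF (h %/ Phi * k) = vadd (nF (h %/ Phi)) (nF k)) -> nF (h * k) = vadd (nF h) (nF k).
  move=> h0 k0 ok lt e; have sr := size_modPhi PhiH h.
  have nhE : nF h = vadd gam (nF (h %/ Phi)).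
    move: lt; rewrite (nuPhi_rec F PhiH h) vmin_vlt vltxx /= => lt.
    by rewrite vmin_r // vltW.
  rewrite [in LHS](Phi_eq Phi h) mulrDl -mulrA nhE.
  rewrite (um_ltDr nF_ultra) (nuPhi_mulPhi F PhiH) // e ?vaddA //.
  apply: (@vlt_le_trans _ (vadd (v (h %% Phi)) (nF k))).
    by rewrite -nhE vlt_addr ?nuPhi0.
  apply: nuPhi_mul_small_ge => //; apply: key_mul_deg_le ok => //.
  exact: leq_modp.
move=> lt_n ok.
have [ltf|] := boolP (vlt (nF f) (v (f %% Phi))).
  apply: drop => //; apply: IHn; first by rewrite -ltnS (leq_trans _ lt_n) // ltnS ltn_add2r; exact: size_div.
  by apply: key_mul_deg_le ok => //; apply/ltnW/size_div.
have [ltg _|] := boolP (vlt (nF g) (v (g %% Phi))).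
  rewrite mulrC vaddC; apply: drop => //; first exact: key_mul_degC.
  apply: IHn; first by rewrite -ltnS (leq_trans _ lt_n) // ltnS addnC ltn_add2l; exact: size_div.
  by apply: key_mul_degC; apply: key_mul_deg_le ok => //; apply/ltnW/size_div.
rewrite -!vleNgt => leg lef.
set a := f %% Phi in lef *; set b := g %% Phi in leg *.
have sa : (size a <= d)%N by exact: size_modPhi PhiH _.
have sb : (size b <= d)%N by exact: size_modPhi PhiH _.
have sa' : (size a <= size f)%N by exact: leq_modp.
have sb' : (size b <= size g)%N by exact: leq_modp.
have va : v a = nF f.
  by apply: vle_anti => //; rewrite [nF f](nuPhi_rec F PhiH) // vmin_vle vle_refl.
have vb : v b = nF g.
  by apply: vle_anti => //; rewrite [nF g](nuPhi_rec F PhiH) // vmin_vle vle_refl.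
have neq0 c h : h != 0 -> v c = nF h -> c != 0.
  by move=> h0 e; apply: contra_neq (nuPhi0 h h0) => c0; rewrite -e c0 ev0 (um0 (nuU F)).
apply: vle_anti; last exact: nuPhi_mul_ge.
have ok' : ltn_ext ((size a).-1 + (size b).-1) N.
  by apply: ltn_ext_le ok; apply: leq_add; rewrite leq_min -!subn1 !leq_sub2r.
have [_ r _] := nuPhi_key sa sb ok' (neq0 _ _ f0 va) (neq0 _ _ g0 vb).
rewrite -va -vb -r (nuPhi_rec F PhiH (f * g)) vmin_vle.
have -> : (a * b) %% Phi = (f * g) %% Phi.
  by rewrite modp_mul mulrC modp_mul mulrC.
by rewrite vle_refl.
Qed.

End KeyPolynomials.

Lemma size_sub_monic (R : nzRingType) (d : nat) (p q : {poly R}) : p \is monic -> q \is monic ->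
  size p = d.+1 -> size q = d.+1 -> (size (p - q)%R <= d)%N.
Proof.
rewrite !monicE !lead_coefE => pm qm sp sq; apply/leq_sizeP => j.
rewrite leq_eqVlt coefB => /orP[/eqP <-|dj]; last by rewrite !nth_default ?subr0 ?sp ?sq.
by move: pm qm; rewrite sp sq /= => /eqP -> /eqP ->; rewrite subrr.
Qed.

(** * Monic polynomials of maximal value are key polynomials *)

Section KeyDegrees.
Variables (K L : fieldType) (iota : {rmorphism K -> L}) (chi : L) (N : option nat).
Variables (Gamma : ordered_group) (nu : L -> option Gamma).
Local Notation ev := (ev iota chi).
Local Notation v p := (nu (ev p)).
Implicit Types a b c f g p q r : {poly K}.
Hypothesis F : pm_facts iota chi N nu.

Let vult := v_ultra F.

(** [Phi] is compared with a given key polynomial [Psi]. Put [Phi = Psi + h], so nu(h) >= nu(Psi) by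
    maximality. Dividing f g by [Psi] instead of [Phi] changes the quotient [Q] into [Q + q1], and
    the key property of [Psi] for the pair ([Q], [h]) gives nu(q1) > nu(Q). Hence nu(f g) < nu(Q) +
    nu(Psi) <= nu(Q) + nu(Phi). *)
Lemma max_is_key d Phi : independent_key_degree iota chi N nu d ->
  Phi \is monic -> size Phi = d.+1 ->
  (exists2 g, v Phi = Some g & is_max (monic_values iota chi nu d) g) ->
  key_poly iota chi N nu d Phi.
Proof.
move=> [[Psi [Psim sPsi [d0 dN] keyP]] _] Phim sPhi [gm vPhi [_ gmax]].
have PsiH : monic_below N Psi d by [].
have PhiH : monic_below N Phi d by [].
have Phi0 := monic_neq0 Phim; have Psi0 := monic_neq0 Psim.
split=> // f g f0 g0 sf sg ok; set Q := _ %/ _; set R := _ %% _.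
have fgE : f * g = Q * Phi + R by rewrite {1}(divp_eq (f * g) Phi).
have fg0 : f * g != 0 by rewrite mulf_neq0.
have sfg : size (f * g) = (size f + size g).-1 by rewrite size_mul.
have okfg : ltn_ext (size (f * g)).-1 N.
  by apply: ltn_ext_le ok; rewrite sfg; move: f0 g0; rewrite -!size_poly_gt0; clear; lia.
have vfg : v (f * g) != None by exact: (v_neqNone F okfg).
(* Only the strict inequality remains to be shown: it forces [R = f * g - Q * Phi] to have the value
   of [f * g]. *)
have suff_lt : vlt (v (f * g)) (v (Q * Phi)) ->
    v (f * g) = v R /\ vlt (v R) (v (Q * Phi)).
  move=> lt; have -> : R = f * g - Q * Phi by rewrite fgE addrAC subrr add0r.
  have e : v (f * g - Q * Phi) = v (f * g) by rewrite (um_ltDl vult) ?(umN vult).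
  by rewrite e.
apply: suff_lt; have [->|Q0] := eqVneq Q 0.
  by rewrite mul0r ev0 (um0 (nuU F)).
have sQ : (0 < size Q)%N by rewrite size_poly_gt0.
have sQE : size Q = (size (f * g)%R - d)%N by rewrite (size_divPhi PhiH).
have vPsi0 := gam_neqNone F PsiH; have vPhi0 := gam_neqNone F PhiH.
have lePsiPhi : vle (v Psi) (v Phi).
  case e: (v Psi) vPsi0 => [x|] // _; rewrite vPhi; apply: gmax.
  by exists Psi.
set h := Phi - Psi; have PhiE : Phi = Psi + h by rewrite addrC subrK.
have leh : vle (v Psi) (v h) by apply: (um_leB vult) => //; exact: vle_refl.
have sh : (size h <= d)%N.
  exact: size_sub_monic.
set q1 := (Q * h) %/ Psi; set r1 := (Q * h) %% Psi.
have QhE : Q * h = q1 * Psi + r1 by rewrite {1}(divp_eq (Q * h) Psi).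
have sR : (size R < size Psi)%N by rewrite sPsi -sPhi ltn_modp.
have sr1 : (size r1 < size Psi)%N by rewrite ltn_modp.
have sQd : (size Q <= d)%N.
  by rewrite sQE sfg leq_subLR; apply: leq_trans (leq_pred _) _; exact: leq_add.
have [qE rE] : (f * g) %/ Psi = Q + q1 /\ (f * g) %% Psi = r1 + R.
  have e : f * g = (Q + q1) * Psi + (r1 + R).
    by rewrite fgE PhiE mulrDr QhE mulrDl !addrA.
  have s : (size (r1 + R)%R < size Psi)%N.
    by rewrite (leq_ltn_trans (size_polyD _ _)) // gtn_max sr1.
  by rewrite e divp_addl_mul_small // modp_addl_mul_small.
have degQ : ltn_ext ((size Q).-1 + d) N.
  by apply: ltn_ext_le okfg; move: sQ; rewrite sQE; clear; lia.
have vQPsi : v (Q * Psi) = vadd (v Q) (v Psi).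
  by apply: (v_mul F); left; rewrite sPsi.
have vQPhi : v (Q * Phi) = vadd (v Q) (v Phi).
  by apply: (v_mul F); left; rewrite sPhi.
have vQ0 : v Q != None.
  by apply: (v_neqNone F) Q0; apply: ltn_ext_le degQ; rewrite leq_addr.
(* nu(Q) + nu(Psi) <= nu(Q h) < nu(q1) + nu(Psi). *)
have ltq1 : vlt (v Q) (v q1).
  have [h0|h0] := eqVneq h 0; first by rewrite /q1 h0 mulr0 div0p ev0 (um0 (nuU F)) vltNone.
  have [->|q10] := eqVneq q1 0; first by rewrite ev0 (um0 (nuU F)) vltNone.
  have degh : ltn_ext ((size Q).-1 + (size h).-1) N.
    by apply: ltn_ext_le degQ; rewrite leq_add2l; exact: leq_trans (leq_pred _) sh.
  have [e lt] := keyP Q h Q0 h0 sQd sh degh.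
  have vq1 : v (q1 * Psi) = vadd (v q1) (v Psi).
    apply: (v_mul F); left; apply: ltn_ext_le degh; rewrite sPsi.
    have : (0 < size q1)%N by rewrite size_poly_gt0.
    have : (0 < size h)%N by rewrite size_poly_gt0.
    by rewrite (size_divPhi PsiH) size_mul //; move: sQ; move: (size Q) (size h) => m n; clear; lia.
  rewrite -(vlt_addr _ _ vPsi0) -vq1; apply: vle_lt_trans lt; rewrite -e.
  rewrite (v_mul F); last by left.
  by apply: vle_add => //; exact: vle_refl.
have [e lt] := keyP f g f0 g0 sf sg ok.
have vq : v (Q + q1) = v Q by rewrite (um_ltDl vult).
rewrite e; apply: (vlt_le_trans lt); rewrite qE (v_mul F).
  by rewrite vq vQPhi; apply: vle_add => //; exact: vle_refl.
left; apply: ltn_ext_le degQ; rewrite sPsi /= leq_add2r -qE (size_divPhi PsiH).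
by rewrite -sQE.
Qed.

End KeyDegrees.

(** * Jump degrees, and the identification of the smallest one with d' *)

Section JumpDegrees.
Variables (K L : fieldType) (iota : {rmorphism K -> L}) (chi : L) (N : option nat).
Variables (Gamma : ordered_group) (nu : L -> option Gamma).
Local Notation ev := (ev iota chi).
Local Notation v p := (nu (ev p)).
Implicit Types a b c f g p q r : {poly K}.
Hypothesis F : pm_facts iota chi N nu.
Hypothesis N_def : ext_degree iota chi N.
Variables (Phi : {poly K}) (d : nat).
Hypothesis Phi_key : key_poly iota chi N nu d Phi.
Hypothesis Phi_max : exists2 g, v Phi = Some g & is_max (monic_values iota chi nu d) g.
Local Notation nF := (nu_Phi iota chi nu Phi).
Local Notation jump := (jump_degree iota chi N nu Phi).

Let PhiH : monic_below N Phi d. Proof. by case: Phi_key => ? ? []. Qed.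
Let vult := v_ultra F.
Let nult := nuPhi_ultra F PhiH.

Lemma jump_poly_neqNone p : p \is monic -> nF p != None.
Proof. by move=> /monic_neq0 p0; exact: (nuPhi_neqNone F PhiH p0). Qed.

(** The minimal polynomial has infinite value, whereas [nF] is finite on nonzero polynomials. *)
Lemma jump_ext_degree n : N = Some n -> jump n.
Proof.
move=> Nn; have := ext_degreeP N_def; rewrite Nn => -[q qmin sq].
have [qm evq _] := qmin.
exists q; split => //; first by right.
by rewrite evq (um0 (nuU F)) vltNone jump_poly_neqNone.
Qed.

Lemma jump_leq k n : jump k -> N = Some n -> (k <= n)%N.
Proof.
move=> [p [pm sp H _]] Nn; have := ext_degreeP N_def; rewrite Nn => -[q qmin sq].
case: H => [|pmin]; first by rewrite Nn => /ltnW.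
by rewrite -ltnS -sp -sq (minpoly_size_eq pmin qmin).
Qed.

Lemma jump_gt k : jump k -> (d < k)%N.
Proof.
move=> [p [pm sp H lt]]; have [_ sPhi d0 dN] := PhiH.
rewrite ltnNge; apply/negP => kd; have [Phim _ _ _] := PhiH.
have {}H : ltn_ext k N.
  exact: ltn_ext_le dN.
have p0 := monic_neq0 pm.
move: kd; rewrite leq_eqVlt => /orP[/eqP kd|kd]; last first.
  by move: lt; rewrite (nuPhi_small F PhiH) ?sp // vltxx.
have sd : size p = d.+1 by rewrite sp kd.
have sh : (size (p - Phi)%R <= d)%N by exact: size_sub_monic.
have lep : vle (v p) (v Phi).
  have vp : v p != None by apply: (v_neqNone F) p0; rewrite sd.
  have [g vPhi [_ gmax]] := Phi_max; case e: (v p) vp => [x|] // _.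
  by rewrite vPhi; apply: gmax; exists p.
(* This is the Phi-expansion of [p]. By maximality both of its terms have value at least nu(p), so
   [p] does not jump. *)
have pE : p = (p - Phi) + Phi * 1 by rewrite mulr1 subrK.
have := lt; rewrite {1}pE (nuPhi_cons F PhiH) // (nuPhi_small F PhiH) ?size_poly1 //.
rewrite (v_1 F) vadd0 vltNge vle_vmin lep andbT (um_leB vult) //; exact: vle_refl.
Qed.

(** The quantification over all jump degrees also covers the absence of jumps, where it puts no
    bound on [p]. *)
Definition below_jumps p : Prop := forall k, jump k -> (size p <= k)%N.

Lemma below_jumps_lt p : below_jumps p -> ltn_ext (size p).-1 N.
Proof.
case Nn: N => [n|] // H; have jn := jump_ext_degree Nn.
have := H _ jn; have := leq_ltn_trans (leq0n _) (jump_gt jn).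
by case: (size p) => //= k; case: n {Nn jn H}.
Qed.

(** [nF] is at most [nu] here; if it were smaller, the monic multiple of [p] would jump in the
    degree of [p] itself. *)
Lemma below_jumps_eq p : below_jumps p -> v p = nF p.
Proof.
move=> pb; have pN := below_jumps_lt pb.
have [->|p0] := eqVneq p 0; first by rewrite ev0 (um0 (nuU F)) (nuPhi0 iota chi nu).
have l0 : lead_coef p != 0 by rewrite lead_coef_eq0.
have sq : size ((lead_coef p)^-1 *: p) = size p by rewrite size_scale ?invr_eq0.
have sp : (0 < size p)%N by rewrite size_poly_gt0.
have e : v ((lead_coef p)^-1 *: p) = nF ((lead_coef p)^-1 *: p).
  apply: vle_anti; last by apply: (nuPhi_le_v F PhiH); left; rewrite sq.
  rewrite vleNgt; apply/negP => lt.
  suff : (size p <= (size p).-1)%N by rewrite -ltnS (prednK sp) ltnn.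
  apply: pb; exists ((lead_coef p)^-1 *: p); split=> //; last by left.
    by rewrite monicE lead_coefZ mulVf.
  by rewrite sq prednK.
have -> : p = lead_coef p *: ((lead_coef p)^-1 *: p) by rewrite scalerA mulfV ?scale1r.
by rewrite (v_scale F) (nuPhi_scale F PhiH) e.
Qed.

(** Suppose nu(q Phi') <= nu(f g). Then nu(r) >= nu(q Phi') > nF(q Phi') and nu(r) = nF(r), so nF(f
    g) = nF(q Phi') < nu(q Phi') <= nu(f g); but [nu] and [nF] agree on f g, both being
    multiplicative there. The first degree hypothesis serves for key polynomials, the second for the
    graded algebra, where deg f + deg g may reach [N]. *)
Lemma jump_reduce (Phi' : {poly K}) e f g : Phi' \is monic -> size Phi' = e.+1 ->
    vlt (nF Phi') (v Phi') -> (forall k, jump k -> (e <= k)%N) ->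
    (size f <= e)%N -> (size g <= e)%N -> f != 0 -> g != 0 ->
    ltn_ext ((size f).-1 + (size g).-1) N \/ field_valuation nu /\ ltn_ext (d.-1 + d.-1) N ->
  vlt (v (f * g)) (v ((f * g) %/ Phi' * Phi')).
Proof.
move=> pm sp lt emin sf sg f0 g0 ok.
have p0 := monic_neq0 pm.
have okv m : (m <= (size f).-1 + (size g).-1)%N -> mul_deg N nu m.
  by move=> le_m; case: ok => [ok|[]]; [left; apply: ltn_ext_le ok|right].
have okF (h k : {poly K}) : ((size h).-1 + (size k).-1 <= (size f).-1 + (size g).-1)%N ->
    key_mul_deg N d h k.
  move=> le_m; case: ok => [ok|[_ ok]]; last exact: key_mul_deg_all.
  by apply: key_mul_deg_of; apply: ltn_ext_le ok.
have small (h : {poly K}) : (size h <= e)%N -> v h = nF h.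
  by move=> sh; apply: below_jumps_eq => k /emin; exact: leq_trans.
set q := _ %/ _; set r := (f * g) %% Phi'.
have fgE : f * g = q * Phi' + r by rewrite {1}(divp_eq (f * g) Phi').
have vfg : v (f * g) = vadd (v f) (v g) by apply: (v_mul F); exact: okv.
have nfg : nF (f * g) = vadd (nF f) (nF g) by apply: (nuPhi_mul F Phi_key); exact: okF.
have evfg : nF (f * g) = v (f * g) by rewrite nfg vfg !small.
have [q0|q0] := eqVneq q 0.
  rewrite q0 mul0r ev0 (um0 (nuU F)) vltNone -evfg.
  by apply: (nuPhi_neqNone F PhiH); rewrite mulf_neq0.
have sq : size q = ((size f + size g).-1 - e)%N.
  by rewrite /q size_divp // sp size_mul.
have degq : ((size q).-1 + (size Phi').-1 <= (size f).-1 + (size g).-1)%N.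
  have : (0 < size q)%N by rewrite size_poly_gt0.
  rewrite sq sp; move: f0 g0; rewrite -!size_poly_gt0.
  by move: (size f) (size g) => m n; clear; lia.
have vq : v q = nF q.
  apply: small; rewrite sq leq_subLR; apply: leq_trans (leq_pred _) _.
  exact: leq_add.
have vqP : v (q * Phi') = vadd (v q) (v Phi') by apply: (v_mul F); exact: okv.
have nqP : nF (q * Phi') = vadd (nF q) (nF Phi').
  by apply: (nuPhi_mul F Phi_key); exact: okF.
have ltq : vlt (nF (q * Phi')) (v (q * Phi')).
  by rewrite nqP vqP vq vlt_addl // (nuPhi_neqNone F PhiH).
have vr : v r = nF r by apply: small; rewrite -ltnS -sp ltn_modp.
rewrite vltNge; apply/negP => le.
have ltr : vlt (nF (q * Phi')) (nF r).
  rewrite -vr; apply: vlt_le_trans ltq _.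
  have -> : r = f * g - q * Phi' by rewrite fgE addrAC subrr add0r.
  by apply: (um_leB vult) => //; exact: vle_refl.
have := vlt_le_trans ltq le.
by rewrite -evfg fgE (um_ltDl nult ltr) vltxx.
Qed.

Lemma jump_key e : jump e -> (forall k, jump k -> (e <= k)%N) -> ltn_ext e N ->
  exists Phi', [/\ key_poly iota chi N nu e Phi' & vlt (nF Phi') (v Phi')].
Proof.
move=> je emin eN; have [p [pm sp _ lt]] := je; exists p; split => //; split => //.
  by split=> //; exact: leq_trans (jump_gt je).
move=> f g f0 g0 sf sg ok.
have ltq := jump_reduce pm sp lt emin sf sg f0 g0 (or_introl ok).
have e1 : v ((f * g) %% p) = v (f * g).
  have -> : (f * g) %% p = f * g - (f * g) %/ p * p.
    by rewrite {2}(divp_eq (f * g) p) addrAC subrr add0r.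
  by rewrite (um_ltDl vult) // (umN vult).
by rewrite e1.
Qed.

Lemma key_degree_jump e : (d < e)%N -> key_degree iota chi N nu e ->
  exists2 k, jump k & (k <= e)%N.
Proof.
move=> de [Psi [Pm sPsi [e0 eN] keyP]].
have [//|nj] := pselect (exists2 k, jump k & (k <= e)%N).
have [Phim sPhi d0 dN] := PhiH; have Phi0 := monic_neq0 Phim.
have Pb : below_jumps Psi.
  by move=> k jk; rewrite sPsi ltnNge; apply/negP => ke; apply: nj; exists k.
have vPsi := below_jumps_eq Pb.
set A := Psi %/ Phi; set B := Psi %% Phi.
have PsiE : Psi = B + Phi * A by exact: Phi_eq.
have sA : size A = (e.+1 - d)%N by rewrite (size_divPhi PhiH) sPsi.
have A0 : A != 0 by rewrite -size_poly_gt0 sA subn_gt0 ltnS ltnW.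
have sB : (size B <= d)%N by exact: (size_modPhi PhiH).
have sB' : (size (- B)%R < size Psi)%N by rewrite size_polyN sPsi ltnS (leq_trans sB) // ltnW.
have PAE : Phi * A = 1 * Psi + - B by rewrite mul1r PsiE addrC addKr.
have sA' : (size A <= e)%N by rewrite sA; move: d0; clear; lia.
have degPA : ltn_ext ((size Phi).-1 + (size A).-1) N.
  by rewrite sPhi sA; apply: ltn_ext_le eN; move: de; clear; lia.
(* The division of [Phi * A] by [Psi] has quotient 1 and remainder [- B]. *)
have [|_] := keyP Phi A Phi0 A0 _ sA' degPA; first by rewrite sPhi.
rewrite PAE modp_addl_mul_small // divp_addl_mul_small // mul1r (umN vult) vPsi.
by rewrite PsiE (nuPhi_cons F PhiH) // vltNge vmin_vle vle_refl.
Qed.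

Lemma smallest_jump_degreeP d' : next_key_degree iota chi N nu d d' ->
  smallest_jump_degree iota chi N nu Phi d'.
Proof.
have [nj|[k jk]] : (forall k, ~ jump k) \/ exists k, jump k.
- by have [?|nj] := pselect (exists k, jump k); [right|left=> k jk; apply: nj; exists k].
- case=> [[e [-> de ke _]]|[_ ->]]; first by have [k /nj] := key_degree_jump de ke.
  suff : forall M, M = N -> smallest_jump_degree iota chi N nu Phi M by exact.
  by case=> [n|] Nn //; case: (nj n); exact: jump_ext_degree.
have exj : exists k, `[< jump k >] by exists k; apply/asboolP.
case: (ex_minnP exj) => e /asboolP je min_e.
have emin m : jump m -> (e <= m)%N by move=> jm; apply: min_e; apply/asboolP.
have de := jump_gt je.
case=> [[e' [-> de' ke' mine']]|[nk ->]].
  have [m jm me'] := key_degree_jump de' ke'.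
  have ee' : (e <= e')%N := leq_trans (emin _ jm) me'.
  have eN : ltn_ext e N.
    by case: ke' => Psi [_ _ [_ e'N] _]; exact: ltn_ext_le e'N.
  have [Phi' [keyP' _]] := jump_key je emin eN.
  have e'e : (e' <= e)%N by apply: mine' => //; exists Phi'.
  by have -> : e' = e by apply/eqP; rewrite eqn_leq e'e.
(* A smallest jump below [N] would be a key degree greater than d; so here e is [N]. *)
have neN : ~~ ltn_ext e N.
  apply/negP => eN; have [Phi' [keyP' _]] := jump_key je emin eN.
  by apply: (nk e de); exists Phi'.
have [n Nn] : exists n, N = Some n by case: (N) neN => [n|] //; exists n.
have ne : (n <= e)%N by move: neN; rewrite Nn /= -leqNgt.
have en : (e <= n)%N by exact: jump_leq Nn.
have neE : n = e by apply/eqP; rewrite eqn_leq ne.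
by rewrite {2}Nn neE; split.
Qed.

Lemma below_jumps_next d' p : next_key_degree iota chi N nu d d' ->
  (forall n, d' = Some n -> (size p <= n)%N) -> below_jumps p.
Proof.
move=> /smallest_jump_degreeP; case: d' => [e|] /=; last by move=> nj _ k /nj.
by move=> [_ emin] /(_ e erefl) sp k /emin; exact: leq_trans.
Qed.

End JumpDegrees.

(** * Inverses modulo Phi, and divisibility of d' by d *)

Section Divisibility.
Variables (K L : fieldType) (iota : {rmorphism K -> L}) (chi : L) (N : option nat).
Variables (Gamma : ordered_group) (nu : L -> option Gamma).
Local Notation ev := (ev iota chi).
Local Notation v p := (nu (ev p)).
Implicit Types a b c f g p q r : {poly K}.
Hypothesis F : pm_facts iota chi N nu.
Hypothesis N_def : ext_degree iota chi N.
Variables (Phi : {poly K}) (d : nat).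
Hypothesis Phi_key : key_poly iota chi N nu d Phi.
Hypothesis Phi_max : exists2 g, v Phi = Some g & is_max (monic_values iota chi nu d) g.
Hypothesis ddN : ltn_ext (d + d) N.
Local Notation nF := (nu_Phi iota chi nu Phi).
Local Notation gam := (v Phi).
Local Notation jump := (jump_degree iota chi N nu Phi).

Let PhiH : monic_below N Phi d. Proof. by case: Phi_key => ? ? []. Qed.
Let vult := v_ultra F.
Let nult := nuPhi_ultra F PhiH.

Lemma small_mul_deg a b : (size a <= d)%N -> (size b <= d)%N ->
  ltn_ext ((size a).-1 + (size b).-1) N.
Proof.
move=> sa sb; apply: ltn_ext_le ddN.
by apply: leq_add; apply: leq_trans (leq_pred _) _.
Qed.

Lemma nuPhi_mul_all f g : nF (f * g) = vadd (nF f) (nF g).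
Proof.
apply: (nuPhi_mul F Phi_key); apply: key_mul_deg_all; apply: ltn_ext_le ddN.
by rewrite leq_add ?leq_pred.
Qed.

Lemma nuPhi_split m b c : (size b <= m * d)%N ->
  nF (b + Phi ^+ m * c) = vmin (nF b) (vadd (vmuln gam m) (nF c)).
Proof.
elim: m b c => [|m IHm] b c sb.
  move: sb; rewrite mul0n leqn0 size_poly_eq0 => /eqP ->.
  rewrite add0r expr0 mul1r (nuPhi0 iota chi nu) vmuln0 ?(gam_neqNone F PhiH) // v0add.
  by rewrite vmin_r ?vle_None.
have sb0 := size_modPhi PhiH b; have sb1 : (size (b %/ Phi)%R <= m * d)%N.
  by rewrite (size_divPhi PhiH) leq_subLR.
have {1}-> : b + Phi ^+ m.+1 * c = b %% Phi + Phi * (b %/ Phi + Phi ^+ m * c).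
  by rewrite {1}(Phi_eq Phi b) mulrDr addrA exprS mulrA.
rewrite (nuPhi_cons F PhiH) // IHm // (nuPhi_rec F PhiH b) vmulnS.
rewrite -vaddA; move: (gam_neqNone F PhiH) (v (b %% Phi)) (nF (b %/ Phi)) (vadd _ (nF c)) => g0 x y z.
have vaddmin : vadd gam (vmin y z) = vmin (vadd gam y) (vadd gam z).
  by rewrite /vmin vle_addl //; case: ifP.
rewrite vaddmin; apply: vle_anti; rewrite !vle_vmin !vmin_vle !vle_refl ?orbT //.
Qed.

(** [Phi] is not a product of two polynomials h, k of degree < d: the key property gives the
    remainder of h k the finite value nu(h) + nu(k), so it is not 0. Hence [a] is invertible modulo
    [Phi], and the last inequality says that the class of [c] is inverse to that of [a] in the
    graded algebra. *)
Lemma small_inverse a : (size a <= d)%N -> a != 0 -> exists c q,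
  [/\ (size c <= d)%N, c != 0, c * a = 1 + Phi * q & vlt (vadd (v c) (v a)) (vadd gam (nF q))].
Proof.
move=> sa a0; have [Phim sPhi d0 _] := PhiH; have Phi0 := monic_neq0 Phim.
have unit_of h k : Phi = h * k -> (size h <= d)%N -> (size k <= d)%N -> False.
  move=> hk sh sk.
  have : h * k != 0 by rewrite -hk.
  rewrite mulf_eq0 negb_or => /andP[h0 k0].
  have [_ r0 _] := nuPhi_key F Phi_key sh sk (small_mul_deg sh sk) h0 k0.
  move: r0; rewrite -hk modpp ev0 (um0 (nuU F)) => /esym/eqP.
  by rewrite vadd_eqNone !(negPf (small_neqNone F Phi_key _ _)).
have /Bezout_eq1_coprimepP[[u w] /= uw] : coprimep a Phi.
  rewrite /coprimep; set h := gcdp a Phi.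
  have h0 : h != 0 by rewrite gcdp_eq0 negb_and a0.
  have sh : (size h <= d)%N by apply: leq_trans sa; apply: dvdp_leq => //; exact: dvdp_gcdl.
  have hP : Phi = (Phi %/ h) * h by rewrite divpK // dvdp_gcdr.
  apply/negPn/negP => s1; apply: (unit_of (Phi %/ h) h hP) => //.
  rewrite -ltnS -sPhi size_divp // ltn_subrL size_poly_gt0 Phi0 andbT -subn1 subn_gt0.
  by rewrite ltn_neqAle eq_sym s1 size_poly_gt0.
set c := u %% Phi.
have sc : (size c <= d)%N by exact: (size_modPhi PhiH).
have caE : (c * a) %% Phi = 1.
  rewrite /c mulrC modp_mul mulrC -[u * a](addrK (w * Phi)) uw.
  by rewrite modpD modpN modp_mull oppr0 addr0 modp_small // size_poly1 sPhi ltnS.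
have c0 : c != 0.
  by apply: contra_eq_neq caE => ->; rewrite mul0r mod0p eq_sym oner_eq0.
have [_ _ lt] := nuPhi_key F Phi_key sc sa (small_mul_deg sc sa) c0 a0.
exists c, ((c * a) %/ Phi); split => //.
by rewrite {1}(Phi_eq Phi (c * a)) caE.
Qed.

(** As in the multiplication of a numeral by a digit, each product of [a] with a coefficient of [b]
    leaves a carry [q], of strictly larger value by the key property; [Phi ^+ m * c] is what leaves
    the first [m] places. *)
Lemma small_mul_split m a b : (size a <= d)%N -> a != 0 -> (size b <= m * d)%N ->
  b != 0 -> exists b' c, [/\ a * b = b' + Phi ^+ m * c, (size b' <= m * d)%N
    & vlt (vadd (v a) (nF b)) (nF (Phi ^+ m * c))].
Proof.
move=> sa a0; elim: m b => [|m IHm] b sb b0.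
  by move: sb; rewrite mul0n leqn0 size_poly_eq0 (negPf b0).
have [Phim sPhi d0 _] := PhiH; have Phi0 := monic_neq0 Phim.
set b0' := b %% Phi; set b1 := b %/ Phi.
have bE : b = b0' + Phi * b1 by exact: Phi_eq.
have sb0 : (size b0' <= d)%N := size_modPhi PhiH b.
have sb1 : (size b1 <= m * d)%N by rewrite (size_divPhi PhiH) leq_subLR.
have nbE : nF b = vmin (v b0') (vadd gam (nF b1)) by rewrite bE (nuPhi_cons F PhiH).
have vaN : v a != None by exact: (small_neqNone F Phi_key).
have nbN : nF b != None by exact: (nuPhi_neqNone F PhiH).
have [r [q [rE sr sq ltq]]] : exists r q, [/\ a * b0' = r + Phi * q, (size r <= d)%N,
    (size q <= d)%N & vlt (vadd (v a) (nF b)) (vadd gam (nF q))].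
  have [->|b00] := eqVneq b0' 0.
    exists 0, 0; rewrite !mulr0 addr0 size_poly0 (nuPhi0 iota chi nu) vaddNone vltNone.
    by rewrite vadd_eqNone negb_or vaN.
  exists ((a * b0') %% Phi), ((a * b0') %/ Phi).
  rewrite -Phi_eq (size_modPhi PhiH); split => //.
    rewrite (size_divPhi PhiH) size_mul // leq_subLR.
    by apply: leq_trans (leq_pred _) _; exact: leq_add.
  have [_ _ lt] := nuPhi_key F Phi_key sa sb0 (small_mul_deg sa sb0) a0 b00.
  apply: vle_lt_trans lt; apply: vle_add; first exact: vle_refl.
  by rewrite nbE vmin_vle vle_refl.
have nPhi_mul h k : nF (Phi ^+ k.+1 * h) = vadd gam (nF (Phi ^+ k * h)).
  by rewrite exprS -mulrA (nuPhi_mulPhi F PhiH).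
have [b10|b10] := eqVneq b1 0.
  have abE : a * b = r + Phi * q by rewrite bE b10 mulr0 addr0.
  (* With a single place the carry [q] is itself [c]; with more places the whole product fits and
     [c = 0]. *)
  case: m IHm sb sb1 => [|m] _ sb sb1.
    by exists r, q; rewrite mul1n expr1 (nuPhi_mulPhi F PhiH).
  exists (a * b), 0; rewrite mulr0 addr0 (nuPhi0 iota chi nu) vltNone vadd_eqNone negb_or vaN.
  split=> //; rewrite abE (leq_trans (size_polyD _ _)) // geq_max; apply/andP; split.
    by apply: leq_trans sr _; rewrite leq_pmull.
  apply: leq_trans (size_polyMleq _ _) _; rewrite sPhi addSn /=.
  by rewrite mulSn mulSn addnA (leq_trans _ (leq_addr _ _)) // leq_add2l.
have [b1' [c [ab1 sb1' ltc]]] := IHm b1 sb1 b10.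
exists (r + Phi * (q + b1')), c; split.
- by rewrite bE mulrDr rE mulrCA ab1 !mulrDr exprS -mulrA !addrA.
- have m0 : (0 < m)%N.
    rewrite lt0n; apply: contra b10 => /eqP m0; move: sb1.
    by rewrite m0 mul0n leqn0 size_poly_eq0.
  rewrite (leq_trans (size_polyD _ _)) // geq_max; apply/andP; split.
    by apply: leq_trans sr _; rewrite leq_pmull.
  apply: leq_trans (size_polyMleq _ _) _; rewrite sPhi addSn /= mulSn leq_add2l.
  rewrite (leq_trans (size_polyD _ _)) // geq_max sb1' andbT.
  by apply: leq_trans sq _; rewrite leq_pmull.
rewrite nPhi_mul; apply: vle_lt_trans (_ : vlt (vadd gam (vadd (v a) (nF b1))) _).
  rewrite vaddCA; apply: vle_add; first exact: vle_refl.
  by rewrite nbE vmin_vle vle_refl orbT.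
by rewrite vlt_addl // (gam_neqNone F PhiH).
Qed.

(* Normalizing the leading coefficient a of the Phi-expansion of Phi' by an
   inverse of a in the graded algebra yields a monic polynomial of degree m d
   which also jumps. *)
Lemma jump_dvd e : jump e -> (forall k, jump k -> (e <= k)%N) ->
  field_valuation nu \/ ltn_ext (e.-1 + e.-1) N -> (d %| e)%N.
Proof.
move=> je emin ok; have [Phi' [Phim' sPhi' _ lt]] := je.
have [Phim sPhi d0 _] := PhiH; have Phi0 := monic_neq0 Phim.
have de : (d < e)%N by exact: (jump_gt F Phi_key Phi_max je).
(* The product of [Phi'] with a polynomial of degree < d has degree at most d + e - 1, and d <= e -
   1. *)
have okv m : (m <= d + e.-1)%N -> mul_deg N nu m.
  move=> me; case: ok => ok; [by right|left; apply: ltn_ext_le ok].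
  by apply: leq_trans me _; rewrite leq_add2r -ltnS (prednK (leq_ltn_trans (leq0n _) de)).
rewrite /dvdn -[_ == _]negbK -lt0n; apply/negP => s0.
(* As d does not divide e, m d is strictly below e, and a jump in degree m d contradicts
   minimality. *)
set m := (e %/ d)%N; have eE : e = (m * d + e %% d)%N by exact: divn_eq.
have sd : (e %% d < d)%N by rewrite ltn_mod.
have Pm : Phi ^+ m \is monic by exact: monic_exp.
have sPm : size (Phi ^+ m) = (m * d).+1 by exact: (size_PhiX PhiH).
set a := Phi' %/ Phi ^+ m; set b := Phi' %% Phi ^+ m.
have PE : Phi' = b + Phi ^+ m * a by rewrite {1}(divp_eq Phi' (Phi ^+ m)) addrC mulrC.
have sa : size a = (e %% d).+1.
  by rewrite size_divp ?monic_neq0 // sPm sPhi' /= {1}eE -addnS addKn.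
have sa' : (size a <= d)%N by rewrite sa.
have a0 : a != 0 by rewrite -size_poly_gt0 sa.
have sb : (size b <= m * d)%N by rewrite -ltnS -sPm ltn_modp monic_neq0.
have [g [q [sg g0 gaE ltg]]] := small_inverse sa' a0.
have vg : nF g = v g by exact: (nuPhi_small F PhiH).
have va : nF a = v a by exact: (nuPhi_small F PhiH).
have nP : nF Phi' = vmin (nF b) (vadd (vmuln gam m) (v a)) by rewrite PE nuPhi_split // va.
pose T := nF (g * Phi'); have TE : T = vadd (v g) (nF Phi') by rewrite /T nuPhi_mul_all vg.
have [b' [c [gbE sb' ltc]]] : exists b' c, [/\ g * b = b' + Phi ^+ m * c,
    (size b' <= m * d)%N & vlt T (nF (Phi ^+ m * c))].
  have [->|b0] := eqVneq b 0.
    exists 0, 0; rewrite !mulr0 addr0 size_poly0 (nuPhi0 iota chi nu) vltNone; split=> //.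
    by apply: (nuPhi_neqNone F PhiH); rewrite mulf_neq0 // monic_neq0.
  have [b' [c [? ? l]]] := small_mul_split sg g0 sb b0; exists b', c; split=> //.
  apply: vle_lt_trans l; rewrite TE; apply: vle_add; first exact: vle_refl.
  by rewrite nP vmin_vle vle_refl.
(* [g * Phi'] has [nF] equal to [T] and [nu] above [T]. The error [E] has both above [T], so
   [P2 = g * Phi' - E] still jumps. *)
set P2 := Phi ^+ m + b'; set E := Phi ^+ m * (Phi * q) + Phi ^+ m * c.
have gPE : g * Phi' = P2 + E.
  rewrite PE mulrDr gbE mulrCA gaE mulrDr mulr1.
  by rewrite addrC addrACA.
have ltE : vlt T (nF E).
  apply: (um_ltD nult) => //; rewrite (nuPhi_mulXPhi F PhiH) (nuPhi_mulPhi F PhiH).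
  apply: vle_lt_trans (_ : vlt (vadd (vmuln gam m) (vadd (v g) (v a))) _).
    rewrite TE vaddCA; apply: vle_add; first exact: vle_refl.
    by rewrite nP vmin_vle vle_refl orbT.
  by rewrite vlt_addl // vmuln_eqNone (gam_neqNone F PhiH).
have sP2 : size P2 = (m * d).+1 by rewrite /P2 size_polyDl sPm.
have P2m : P2 \is monic by rewrite monicE /P2 lead_coefDl ?sPm // -monicE.
have mde : (m * d < e)%N by rewrite [X in (_ < X)%N]eE -[X in (X < _)%N]addn0 ltn_add2l.
have leE : vle (nF E) (v E).
  apply: (nuPhi_le_v F PhiH); apply: okv.
  have -> : E = g * Phi' - P2 by rewrite gPE addrAC subrr add0r.
  have : (size (g * Phi' - P2)%R <= d + e)%N.
    rewrite (leq_trans (size_polyD _ _)) // size_polyN geq_max sP2; apply/andP; split.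
      by apply: leq_trans (size_polyMleq _ _) _; rewrite sPhi' addnS /= leq_add2r.
    by apply: leq_trans mde _; exact: leq_addl.
  by move: (size _) de => n; clear; lia.
have vgP : v (g * Phi') = vadd (v g) (v Phi').
  apply: (v_mul F); apply: okv; rewrite sPhi'; move: sg; rewrite -size_poly_gt0 in g0; move: g0 de.
  by move: (size g) => n; clear; lia.
have vgN : v g != None by exact: (small_neqNone F Phi_key).
have ltP2 : vlt T (v P2).
  have -> : P2 = g * Phi' - E by rewrite gPE addrK.
  apply: (um_ltB vult); first by rewrite vgP TE vlt_addl.
  exact: vlt_le_trans leE.
have nP2 : nF P2 = T.
  apply: (um_near nult (x := g * Phi')).
  by have -> : g * Phi' - P2 = E by rewrite gPE addrAC subrr add0r.
have jP2 : jump (m * d)%N.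
  exists P2; split => //; last by rewrite nP2.
  left; case Nn: N => [n|] //; apply: leq_trans mde _.
  exact: (jump_leq N_def je Nn).
by have := emin _ jP2; rewrite leqNgt mde.
Qed.

End Divisibility.

(** * Polynomials of bounded size *)

Definition size_le (K : fieldType) (e : option nat) (p : {poly K}) : Prop :=
  forall n, e = Some n -> (size p <= n)%N.

Section SizeLe.
Variables (K : fieldType) (e : option nat).
Implicit Types p q : {poly K}.

Lemma size_le0 : size_le e (0 : {poly K}).
Proof. by move=> n _; rewrite size_poly0. Qed.

Lemma size_leD p q : size_le e p -> size_le e q -> size_le e (p + q).
Proof.
by move=> sp sq n en; rewrite (leq_trans (size_polyD _ _)) // geq_max sp ?sq.
Qed.

Lemma size_leN p : size_le e p -> size_le e (- p).
Proof. by move=> sp n en; rewrite size_polyN sp. Qed.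

Lemma size_leB p q : size_le e p -> size_le e q -> size_le e (p - q).
Proof. by move=> sp /size_leN; exact: size_leD. Qed.

Lemma size_le_sum (I : eqType) (r : seq I) (P : pred I) (f : I -> {poly K}) :
  (forall i, i \in r -> P i -> size_le e (f i)) -> size_le e (\sum_(i <- r | P i) f i).
Proof.
move=> H; rewrite big_seq_cond; elim/big_ind: _ => //; first exact: size_le0.
  by move=> p q; exact: size_leD.
by move=> i /andP[]; exact: H.
Qed.

End SizeLe.

(** * The graded algebra, built from lists of homogeneous polynomials *)

Section GradedAlgebra.
Variables (K L : fieldType) (iota : {rmorphism K -> L}) (chi : L).
Variables (Gamma : ordered_group) (nu : L -> option Gamma).
Local Notation ev := (ev iota chi).
Local Notation v p := (nu (ev p)).
Implicit Types f g p q r : {poly K}.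
Hypothesis nu_ultra : ultrametric nu.
Hypothesis nu_1 : nu 1 = Some 0.
Variables (e : option nat) (w : {poly K} -> option Gamma).
(* nu need not be multiplicative on triple products of elements of K_{e-1}[chi];
   associativity comes from a valuation w of K[X] which extends nu. *)
Hypothesis w_ultra : ultrametric w.
Hypothesis w_mul : forall f g, w (f * g) = vadd (w f) (w g).
Hypothesis w_v : forall p, size_le e p -> w p = v p.

(** [r] represents the class of f g for both valuations: [w] governs the product of lists, and [nu]
    the formula in(x) in(y) = in(xy) in [L]. *)
Definition gr_mul_closed (e1 : option nat) : Prop := forall f g,
  size_le e1 f -> size_le e1 g -> f != 0 -> g != 0 ->
  exists r, [/\ size_le e1 r, vlt (w (f * g)) (w (f * g - r))
    & v (f * g) = w (f * g) /\ vlt (w (f * g)) (v (f * g - r))].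

(* A list of pairs (h, p) stands for the sum of the classes of the p, each taken
   in degree h of the graded algebra of w. *)
Definition gr_coef (s : seq (Gamma * {poly K})) (h : Gamma) : {poly K} :=
  \sum_(x <- s | x.1 == h) x.2.

Definition gr_conv (s t : seq (Gamma * {poly K})) : seq (Gamma * {poly K}) :=
  [seq (x.1 + y.1, x.2 * y.2) | x <- s, y <- t].

(* In degree h, the class of p has a representative in K_{e1-1}[chi]. *)
Definition gr_wf (e1 : option nat) (s : seq (Gamma * {poly K})) : Prop :=
  forall x, x \in s -> vle (Some x.1) (w x.2) /\
    exists2 r, size_le e1 r & vlt (Some x.1) (w (x.2 - r)).

(** The class is taken through a representative [r], because [w] and [nu] are known to agree only on
    [size_le e], a range that the coefficients of a product can leave. *)
Definition gr_of (s : seq (Gamma * {poly K})) : gr L Gamma :=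
  fun h => [set y | exists r, [/\ size_le e r, vlt (Some h) (w (gr_coef s h - r))
                               & vlt (Some h) (nu (y - ev r))]].

Definition gr_equiv (s t : seq (Gamma * {poly K})) : Prop :=
  forall h, vlt (Some h) (w (gr_coef s h - gr_coef t h)).

Local Notation coset := (coset nu).

Lemma cosetP h x y : coset h x = coset h y <-> vlt (Some h) (nu (x - y)).
Proof.
split=> [e_xy|lt].
  have : coset h x x by rewrite /Defs.coset /= subrr (um0 nu_ultra).
  by rewrite e_xy.
apply/seteqP; split=> z; rewrite /Defs.coset /= => lz.
  by rewrite -(subrK x z) -addrA; exact: (um_ltD nu_ultra).
rewrite -(subrK y z) -addrA; apply: (um_ltD nu_ultra) => //.
by rewrite (umBC nu_ultra).
Qed.

Lemma gr_of_coset s h r : size_le e r -> vlt (Some h) (w (gr_coef s h - r)) ->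
  gr_of s h = coset h (ev r).
Proof.
move=> sr lt; apply/seteqP; split=> y; last by move=> ly; exists r.
move=> [r' [sr' lt' ly]]; rewrite /Defs.coset /=.
rewrite -(subrK (ev r') y) -addrA; apply: (um_ltD nu_ultra) => //.
rewrite -evB -w_v; last exact: size_leB.
rewrite -(subrK (gr_coef s h) r') -addrA; apply: (um_ltD w_ultra) => //.
by rewrite (umBC w_ultra).
Qed.

Lemma gr_equiv_sym s t : gr_equiv s t -> gr_equiv t s.
Proof. by move=> st h; rewrite (umBC w_ultra). Qed.

Lemma gr_of_equiv s t : gr_equiv s t -> gr_of s = gr_of t.
Proof.
have sub s' t' h : gr_equiv s' t' -> gr_of s' h `<=` gr_of t' h.
  move=> st y [r [sr lt ly]]; exists r; split=> //.
  rewrite -(subrK (gr_coef s' h) (gr_coef t' h)) -addrA; apply: (um_ltD w_ultra) => //.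
  exact: gr_equiv_sym st h.
by move=> st; apply/funext => h; apply/seteqP; split; apply: sub => //; exact: gr_equiv_sym.
Qed.

Lemma gr_wf_coef e1 s h : gr_wf e1 s -> vle (Some h) (w (gr_coef s h)) /\
  exists2 r, size_le e1 r & vlt (Some h) (w (gr_coef s h - r)).
Proof.
elim: s => [|x s IHs] wf; rewrite /gr_coef.
  rewrite big_nil (um0 w_ultra); split=> //; exists 0; first exact: size_le0.
  by rewrite subr0 (um0 w_ultra).
have [|le [r sr lt]] := IHs.
  by move=> y ys; apply: wf; rewrite in_cons ys orbT.
have [lex [rx srx ltx]] := wf x (mem_head _ _).
rewrite big_cons; case: ifP => [/eqP xh|_]; last by split=> //; exists r.
rewrite xh in lex ltx; split; first exact: (um_leD w_ultra).
exists (rx + r); first exact: size_leD.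
by rewrite opprD addrACA; exact: (um_ltD w_ultra).
Qed.

Lemma gr_of_inj s t : gr_wf e s -> gr_wf e t -> gr_of s = gr_of t -> gr_equiv s t.
Proof.
move=> ws wt est h.
have [_ [r sr lt]] := gr_wf_coef h ws; have [_ [r' sr' lt']] := gr_wf_coef h wt.
have := gr_of_coset sr lt; rewrite est (gr_of_coset sr' lt') => /cosetP.
rewrite -evB -w_v => [l|]; last exact: size_leB.
rewrite -(subrK r (gr_coef s h)) -addrA; apply: (um_ltD w_ultra) => //.
rewrite -(subrK r' r) -addrA; apply: (um_ltD w_ultra) => //.
  by rewrite (umBC w_ultra).
by rewrite (umBC w_ultra).
Qed.

Lemma gr_coef_cat s t h : gr_coef (s ++ t) h = gr_coef s h + gr_coef t h.
Proof. by rewrite /gr_coef big_cat. Qed.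

(** Associativity and additivity of the product become exact identities in K[X], without error
    terms. *)
Lemma gr_coef_conv s t h : gr_coef (gr_conv s t) h = \sum_(x <- s) x.2 * gr_coef t (h - x.1).
Proof.
rewrite /gr_coef big_mkcond /gr_conv big_allpairs_dep /=; apply: eq_bigr => x _.
rewrite mulr_sumr [RHS]big_mkcond; apply: eq_bigr => y _.
by have -> : (y.1 == h - x.1) = (x.1 + y.1 == h) by rewrite eq_sym subr_eq addrC eq_sym.
Qed.

Lemma gr_coef_convC s t h : gr_coef (gr_conv s t) h = gr_coef (gr_conv t s) h.
Proof.
rewrite /gr_coef big_mkcond [RHS]big_mkcond /gr_conv !big_allpairs_dep /= exchange_big /=.
by apply: eq_bigr => x _; apply: eq_bigr => y _; rewrite addrC mulrC.
Qed.

Lemma gr_coef_convA s t u h :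
  gr_coef (gr_conv s (gr_conv t u)) h = gr_coef (gr_conv (gr_conv s t) u) h.
Proof.
rewrite !gr_coef_conv {2}/gr_conv big_allpairs_dep /=; apply: eq_bigr => x _.
rewrite gr_coef_conv mulr_sumr; apply: eq_bigr => y _.
by rewrite mulrA opprD addrA.
Qed.

Lemma gr_coef_conv_catl s t u h :
  gr_coef (gr_conv (s ++ t) u) h = gr_coef (gr_conv s u ++ gr_conv t u) h.
Proof. by rewrite gr_coef_cat !gr_coef_conv big_cat. Qed.

Lemma gr_conv_equivr e1 s t t' : gr_wf e1 s -> gr_equiv t t' ->
  gr_equiv (gr_conv s t) (gr_conv s t').
Proof.
move=> ws tt' h; rewrite !gr_coef_conv -sumrB big_seq.
apply: (um_lt_sum w_ultra) => x /ws[lex _]; rewrite -mulrBr w_mul.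
have := vle_lt_add _ lex (tt' (h - x.1)) => /(_ isT) /=.
by rewrite addrC subrK.
Qed.

Lemma gr_wf_cat e1 s t : gr_wf e1 s -> gr_wf e1 t -> gr_wf e1 (s ++ t).
Proof. by move=> ws wt x; rewrite mem_cat => /orP[/ws|/wt]. Qed.

Lemma gr_wf_nil e1 : gr_wf e1 [::]. Proof. by []. Qed.

Lemma gr_wf1 e1 h p : size_le e1 p -> vle (Some h) (w p) -> gr_wf e1 [:: (h, p)].
Proof.
move=> sp le x; rewrite inE => /eqP ->; split=> //; exists p => //.
by rewrite subrr (um0 w_ultra).
Qed.

(** Replacing the factors by their representatives [r], [q] costs [(x.2 - r) * y.2 + r * (y.2 - q)],
    of value above [x.1 + y.1]; closure then gives a representative of [r * q]. *)
Lemma gr_wf_conv e1 s t : gr_mul_closed e1 -> gr_wf e1 s -> gr_wf e1 t ->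
  gr_wf e1 (gr_conv s t).
Proof.
move=> cl ws wt _ /allpairsP[[x y] /= [/ws[lex [r sr ltx]] /wt[ley [q sq lty]] ->]] /=.
have ler : vle (Some x.1) (w r).
  rewrite -[r](subrK x.2) ; apply: (um_leD w_ultra) => //.
  by apply: vltW; rewrite (umBC w_ultra).
have leq : vle (Some y.1) (w q).
  rewrite -[q](subrK y.2) ; apply: (um_leD w_ultra) => //.
  by apply: vltW; rewrite (umBC w_ultra).
have le_add a b : vle (Some x.1) a -> vle (Some y.1) b -> vle (Some (x.1 + y.1)) (vadd a b).
  exact: vle_add.
split; first by rewrite w_mul; exact: le_add.
suff [z sz ltz] : exists2 z, size_le e1 z & vlt (Some (x.1 + y.1)) (w (r * q - z)).
  exists z => //; rewrite -(subrK (r * q) (x.2 * y.2)) -addrA.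
  apply: (um_ltD w_ultra) => //.
  have -> : x.2 * y.2 - r * q = (x.2 - r) * y.2 + r * (y.2 - q).
    by rewrite mulrBl mulrBr addrA subrK.
  apply: (um_ltD w_ultra); rewrite w_mul.
    exact: (@vlt_le_add _ (Some x.1) _ (Some y.1)).
  exact: (@vle_lt_add _ (Some x.1) _ (Some y.1)).
have [->|r0] := eqVneq r 0.
  by exists 0; rewrite ?mul0r ?subr0 ?(um0 w_ultra) //; exact: size_le0.
have [->|q0] := eqVneq q 0.
  by exists 0; rewrite ?mulr0 ?subr0 ?(um0 w_ultra) //; exact: size_le0.
have [z [sz ltz _]] := cl r q sr sq r0 q0; exists z => //.
by apply: vle_lt_trans ltz; rewrite w_mul; exact: le_add.
Qed.

Lemma gr_of_nil : gr_of [::] = gr0 nu.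
Proof.
apply/funext => h; rewrite (@gr_of_coset _ _ 0); first by rewrite ev0.
  exact: size_le0.
by rewrite /gr_coef big_nil subr0 (um0 w_ultra).
Qed.

Lemma gr_of_cat s t : gr_wf e s -> gr_wf e t -> gr_of (s ++ t) = grD (gr_of s) (gr_of t).
Proof.
move=> ws wt; apply/funext => h.
have [_ [r sr lt]] := gr_wf_coef h ws; have [_ [r' sr' lt']] := gr_wf_coef h wt.
rewrite /grD (gr_of_coset sr lt) (gr_of_coset sr' lt') (@gr_of_coset _ _ (r + r')).
- rewrite evD; apply/seteqP; split=> z; rewrite /Defs.coset /=.
    move=> lz; exists (z - ev r'); first by rewrite /= addrAC -addrA -opprD.
    by exists (ev r'); rewrite ?subrK //= subrr (um0 nu_ultra).
  by move=> [x lx [y ly <-]]; rewrite opprD addrACA; exact: (um_ltD nu_ultra).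
- exact: size_leD.
by rewrite gr_coef_cat opprD addrACA; exact: (um_ltD w_ultra).
Qed.

Lemma gr_of_big n (t : 'I_n -> seq (Gamma * {poly K})) (a : 'I_n -> gr L Gamma) :
  (forall i, gr_wf e (t i)) -> (forall i, a i = gr_of (t i)) ->
  \big[@grD L Gamma/gr0 nu]_(i < n) a i = gr_of (\big[cat/[::]]_(i < n) t i)
  /\ gr_wf e (\big[cat/[::]]_(i < n) t i).
Proof.
move=> wt at_; elim/big_ind2: _ => //.
- by rewrite gr_of_nil.
- by move=> s1 t1 s2 t2 [-> w1] [-> w2]; rewrite gr_of_cat //; split=> //; exact: gr_wf_cat.
Qed.

Lemma gr_coef_big n (t : 'I_n -> seq (Gamma * {poly K})) h :
  gr_coef (\big[cat/[::]]_(i < n) t i) h = \sum_(i < n) gr_coef (t i) h.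
Proof.
by apply: (big_morph (gr_coef^~ h)) => [s s'|]; [exact: gr_coef_cat|rewrite /gr_coef big_nil].
Qed.

Lemma gr_in_of p h r : v p = Some h -> size_le e r -> vlt (Some h) (w (p - r)) ->
  vlt (Some h) (v (p - r)) -> gr_in nu (ev p) = gr_of [:: (h, p)].
Proof.
move=> vp sr ltw ltv; apply/funext => k; rewrite /gr_in vp.
have [[<-]|kh] := eqVneq (Some h) (Some k).
  rewrite (@gr_of_coset _ _ r) //; first by apply/cosetP; rewrite -evB.
  by rewrite /gr_coef big_cons big_nil eqxx /= addr0.
rewrite (@gr_of_coset _ _ 0) ?ev0 //; first exact: size_le0.
rewrite /gr_coef big_cons big_nil subr0 /=; case: ifP => [/eqP hk|_].
  by rewrite hk eqxx in kh.
by rewrite (um0 w_ultra).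
Qed.

Lemma gr_in_small p h : size_le e p -> v p = Some h -> gr_in nu (ev p) = gr_of [:: (h, p)].
Proof.
by move=> sp vp; apply: (@gr_in_of _ _ p); rewrite ?subrr ?ev0 ?(um0 nu_ultra) ?(um0 w_ultra).
Qed.

Definition gr_reps (e1 : option nat) (s : seq (Gamma * {poly K})) : Prop :=
  forall x, x \in s -> size_le e1 x.2 /\ vle (Some x.1) (w x.2).

Lemma gr_reps_wf e1 s : gr_reps e1 s -> gr_wf e1 s.
Proof.
move=> rs x /rs[sx lex]; split=> //; exists x.2 => //.
by rewrite subrr (um0 w_ultra).
Qed.

Lemma gr_wf_sub e1 s : (forall p, size_le e1 p -> size_le e p) -> gr_wf e1 s -> gr_wf e s.
Proof. by move=> sub ws x /ws[le [r /sub sr lt]]; split=> //; exists r. Qed.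

Lemma gr_ofP e1 u : (forall p, size_le e1 p -> size_le e p) ->
  G nu (Kpoly iota chi e1) u -> exists2 s, gr_reps e1 s & u = gr_of s.
Proof.
move=> sub [uc /finite_seqP[s0 s0E]].
have /choice[c cP] : forall h, exists p, [/\ size_le e1 p, vle (Some h) (w p)
    & u h = coset h (ev p)].
  move=> h; have [x [[p sp ->] le uE]] := uc h; exists p; split=> //.
  by rewrite w_v //; exact: sub.
(* A degree repeated in [s0] would add its representative several times. *)
pose s := [seq (h, c h) | h <- undup s0].
have cs h : gr_coef s h = if h \in s0 then c h else 0.
  rewrite /gr_coef /s big_map /= big_mkcond.
  case: ifP => hs; last first.
    rewrite big_seq big1 // => k; rewrite mem_undup; case: eqP => // -> ks.
    by rewrite ks in hs.
  rewrite (bigD1_seq h) ?undup_uniq ?mem_undup //= eqxx big1 ?addr0 //.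
  by move=> k /negbTE ->.
exists s.
  by move=> _ /mapP[h _ ->]; have [] := cP h.
apply/funext => h; have [sc _ uh] := cP h.
case hs: (h \in s0).
  rewrite uh (@gr_of_coset _ _ (c h)) //; first exact: sub.
  by rewrite cs hs subrr (um0 w_ultra).
have -> : u h = gr0 nu h.
  apply: contrapT => nh; have : [set` s0] h by rewrite -s0E.
  by rewrite /= hs.
rewrite (@gr_of_coset _ _ 0); first by rewrite ev0.
  exact: size_le0.
by rewrite cs hs subr0 (um0 w_ultra).
Qed.

Lemma gr_of_mem e1 s : (forall p, size_le e1 p -> size_le e p) -> gr_wf e1 s ->
  G nu (Kpoly iota chi e1) (gr_of s).
Proof.
move=> sub ws; split=> [h|].
  have [le [r sr lt]] := gr_wf_coef h ws; exists (ev r); split; first by exists r.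
    rewrite -w_v; last exact: sub.
    rewrite -[r](subrK (gr_coef s h)); apply: (um_leD w_ultra) => //.
    by apply: vltW; rewrite (umBC w_ultra).
  by rewrite (gr_of_coset (sub _ sr) lt).
apply: (@sub_finite_set _ _ [set` map fst s]); last exact: finite_seq.
move=> h /= nh; apply: contrapT => hs; apply: nh.
rewrite (@gr_of_coset _ _ 0); [by rewrite ev0|exact: size_le0|].
rewrite /gr_coef big_seq_cond big1 ?subr0 ?(um0 w_ultra) // => x /andP[xs /eqP xh].
by case: hs; rewrite /= -xh map_f.
Qed.

(** A choice that extends the multiplication to all families; those not represented by a list get
    the empty one. [gr_mulE] shows that the choice does not affect products. *)
Definition gr_rep (u : gr L Gamma) : seq (Gamma * {poly K}) :=
  xget [::] [set s | gr_wf e s /\ gr_of s = u].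

Definition gr_mul (u u' : gr L Gamma) : gr L Gamma := gr_of (gr_conv (gr_rep u) (gr_rep u')).

Lemma gr_mulE s t : gr_wf e s -> gr_wf e t -> gr_mul (gr_of s) (gr_of t) = gr_of (gr_conv s t).
Proof.
move=> ws wt; rewrite /gr_mul.
have repP s' : gr_wf e s' -> gr_wf e (gr_rep (gr_of s')) /\ gr_equiv (gr_rep (gr_of s')) s'.
  move=> ws'; have : exists s'', gr_wf e s'' /\ gr_of s'' = gr_of s' by exists s'.
  by move=> /(xgetPex [::])[? ?]; split => //; exact: gr_of_inj.
have [ws' ss'] := repP s ws; have [wt' tt'] := repP t wt.
rewrite (gr_of_equiv (gr_conv_equivr ws' tt')).
have eqC s1 s2 : gr_of (gr_conv s1 s2) = gr_of (gr_conv s2 s1).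
  by apply: gr_of_equiv => h; rewrite gr_coef_convC subrr (um0 w_ultra).
by rewrite eqC (gr_of_equiv (gr_conv_equivr wt ss')) eqC.
Qed.

Lemma gr_of_eq s t : (forall h, gr_coef s h = gr_coef t h) -> gr_of s = gr_of t.
Proof. by move=> st; apply: gr_of_equiv => h; rewrite st subrr (um0 w_ultra). Qed.

(** The multiplication built for the range [e] serves every closed subrange [e1], so a single [mu]
    makes K_{d-1}[chi] act on K_{d'-1}[chi]. *)
Lemma gr_graded_algebra e1 : (forall p, size_le e1 p -> size_le e p) ->
  size_le e1 (1 : {poly K}) -> gr_mul_closed e1 -> (forall y, nu y = None -> y = 0) ->
  graded_algebra nu gr_mul (Kpoly iota chi e1).
Proof.
move=> sub s1 cl nu_inj.
have one : gr_in nu 1 = gr_of [:: (0, 1)] by rewrite -[in LHS](ev1 iota chi) (@gr_in_small _ 0) ?ev1 //; exact: sub.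
have wf1 : gr_wf e1 [:: (0, 1)] by apply: gr_wf1 => //; rewrite w_v ?ev1 ?nu_1 ?vle_refl //; exact: sub.
have inG s : gr_wf e1 s -> G nu (Kpoly iota chi e1) (gr_of s) by exact: gr_of_mem.
have wfE u : G nu (Kpoly iota chi e1) u -> exists2 s, gr_wf e1 s & u = gr_of s.
  by move=> /(gr_ofP sub)[s /gr_reps_wf ws ->]; exists s.
have wfs s : gr_wf e1 s -> gr_wf e s by exact: gr_wf_sub.
have wfc s t : gr_wf e1 s -> gr_wf e1 t -> gr_wf e1 (gr_conv s t) by exact: gr_wf_conv.
split.
- move=> _ _ /wfE[s ws ->] /wfE[t wt ->]; rewrite gr_mulE; try exact: wfs.
  exact/inG/wfc.
- by rewrite one; exact: inG.
- move=> _ _ [f sf ->] [g sg ->] evf evg.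
  have f0 : f != 0 by apply: contra_neq evf => ->; rewrite ev0.
  have g0 : g != 0 by apply: contra_neq evg => ->; rewrite ev0.
  have [r [sr ltw [vE ltv]]] := cl f g sf sg f0 g0.
  case vf : (v f) => [x|]; last by rewrite (nu_inj _ vf) eqxx in evf.
  case vg : (v g) => [y|]; last by rewrite (nu_inj _ vg) eqxx in evg.
  have sf' := sub _ sf; have sg' := sub _ sg.
  have wfg : w (f * g) = Some (x + y) by rewrite w_mul !w_v // vf vg.
  rewrite (gr_in_small sf' vf) (gr_in_small sg' vg) gr_mulE.
  + rewrite -evM (@gr_in_of _ (x + y) r) ?vE //; try by rewrite -wfg.
    exact: sub.
  + by apply: gr_wf1 => //; rewrite w_v // vf vle_refl.
  + by apply: gr_wf1 => //; rewrite w_v // vg vle_refl.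
- move=> h k _ _ /wfE[s ws ->] /wfE[t wt ->] hs kt.
  (* A homogeneous class is represented by a list with a single entry, and the product of two such
     lists has a single degree. *)
  have hom s' h' : gr_wf e1 s' -> gr_homogeneous nu h' (gr_of s') ->
      gr_wf e [:: (h', gr_coef s' h')] /\ gr_of s' = gr_of [:: (h', gr_coef s' h')].
    move=> ws' hs'; have [le [r sr lt]] := gr_wf_coef h' ws'.
    have wf' : gr_wf e [:: (h', gr_coef s' h')].
      move=> x; rewrite inE => /eqP ->; split=> //; exists r => //; exact: sub.
    split=> //; apply: gr_of_equiv => h1.
    rewrite {2}/gr_coef big_cons big_nil /= addr0; case: eqP => [<-|/eqP ne].
      by rewrite subrr (um0 w_ultra).
    have [le1 [r1 sr1 lt1]] := gr_wf_coef h1 ws'.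
    have := hs' h1; rewrite eq_sym in ne => /(_ (elimN eqP ne)).
    rewrite (gr_of_coset (sub _ sr1) lt1) => /cosetP; rewrite subr0 -w_v; last exact: sub.
    by move=> l; rewrite subr0 -(subrK r1 (gr_coef s' h1)); exact: (um_ltD w_ultra).
  have [wh ->] := hom s h ws hs; have [wk ->] := hom t k wt kt.
  rewrite gr_mulE // => l lhk; rewrite -gr_of_nil.
  have -> : gr_of [::] l = coset l (ev 0).
    apply: gr_of_coset; first exact: size_le0.
    by rewrite /gr_coef big_nil subr0 (um0 w_ultra).
  apply: gr_of_coset; first exact: size_le0.
  rewrite /gr_coef big_cons big_nil /=; case: eqP => [hk|_]; first by case: lhk.
  by rewrite subr0 (um0 w_ultra).
- move=> _ _ _ /wfE[s ws ->] /wfE[t wt ->] /wfE[u wu ->].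
  have [[ws' wt'] wu'] := (wfs _ ws, wfs _ wt, wfs _ wu).
  have wc := gr_wf_cat ws' wt'; have wsu := wfs _ (wfc _ _ ws wu).
  have wtu := wfs _ (wfc _ _ wt wu); rewrite -gr_of_cat // !gr_mulE // -gr_of_cat //.
  by apply: gr_of_eq => h; rewrite gr_coef_conv_catl.
- move=> _ _ _ /wfE[s ws ->] /wfE[t wt ->] /wfE[u wu ->].
  have [[ws' wt'] wu'] := (wfs _ ws, wfs _ wt, wfs _ wu).
  have wst := wfs _ (wfc _ _ ws wt).
  have wtu := wfs _ (wfc _ _ wt wu); rewrite !gr_mulE //.
  by apply: gr_of_eq => h; rewrite gr_coef_convA.
- move=> _ _ /wfE[s ws ->] /wfE[t wt ->].
  have [ws' wt'] := (wfs _ ws, wfs _ wt); rewrite !gr_mulE //.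
  by apply: gr_of_eq => h; rewrite gr_coef_convC.
- move=> _ /wfE[s ws ->]; rewrite one gr_mulE; [|exact: wfs|exact: wfs].
  by apply: gr_of_eq => h; rewrite gr_coef_conv big_seq1 mul1r subr0.
Qed.

End GradedAlgebra.

(** * The basis of powers of Phi, and the dimension *)

Section GradedDimension.
Variables (K L : fieldType) (iota : {rmorphism K -> L}) (chi : L) (N : option nat).
Variables (Gamma : ordered_group) (nu : L -> option Gamma).
Local Notation ev := (ev iota chi).
Local Notation v p := (nu (ev p)).
Implicit Types f g p q r : {poly K}.
Hypothesis F : pm_facts iota chi N nu.
Variables (e : option nat) (w : {poly K} -> option Gamma).
Hypothesis w_ultra : ultrametric w.
Hypothesis w_mul : forall f g, w (f * g) = vadd (w f) (w g).
Hypothesis w_v : forall p, size_le e p -> w p = v p.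
Variables (Phi : {poly K}) (d : nat).
Hypothesis PhiH : monic_below N Phi d.
Hypothesis v_nF : forall p, size_le e p -> v p = nu_Phi iota chi nu Phi p.
Hypothesis e_gt : forall n, e = Some n -> (d < n)%N.
Hypothesis e_dvd : forall n, e = Some n -> (d %| n)%N.
Hypothesis e_closed : gr_mul_closed iota chi nu w e.

Local Notation nF := (nu_Phi iota chi nu Phi).
Local Notation gam := (v Phi).
Local Notation E := (gr_of iota chi nu e w).
Local Notation mu := (gr_mul iota chi nu e w).
Local Notation wf := (gr_wf w).

Let nuu := nuU F.
Let nilE := gr_of_nil nuu w_ultra w_v.

Lemma size_le_d p : size_le (Some d) p -> size_le e p.
Proof. by move=> sp n /e_gt dn; apply: leq_trans (sp _ erefl) (ltnW dn). Qed.

Lemma size_le_Phi : size_le e Phi.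
Proof. by have [_ sPhi _ _] := PhiH; move=> n /e_gt; rewrite sPhi. Qed.

(** Divisibility is what matters: i d < k d leaves room for a whole block of d coefficients. *)
Lemma size_le_PhiX i (c : {poly K}) : size_le e (Phi ^+ i) -> (size c <= d)%N -> size_le e (c * Phi ^+ i).
Proof.
have [Phim sPhi d0 _] := PhiH => si sc n en.
have /dvdnP[k nk] := e_dvd en; have := si n en.
rewrite (size_PhiX PhiH) nk ltn_mul2r d0 /= => ik.
apply: leq_trans (size_polyMleq _ _) _; rewrite (size_PhiX PhiH) addnS /=.
by rewrite (leq_trans _ (leq_mul ik (leqnn d))) // mulSn leq_add2r.
Qed.

Lemma w_PhiX i : w (Phi ^+ i) = vmuln gam i.
Proof.
have w1 : w 1 = Some 0.
  have s1 : size_le (Some d) (1 : {poly K}).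
    by move=> n [<-]; rewrite size_poly1; case: PhiH.
  by rewrite w_v ?ev1 ?(nu1 F) //; exact: size_le_d.
elim: i => [|i IHi]; first by rewrite expr0 w1 vmuln0 // (gam_neqNone F PhiH).
by rewrite exprS w_mul IHi vmulnS w_v //; exact: size_le_Phi.
Qed.

Lemma gam_Some : exists gm, gam = Some gm.
Proof. by have := gam_neqNone F PhiH; case: (gam) => // gm _; exists gm. Qed.

Lemma gr_in_PhiX gm i : gam = Some gm -> size_le e (Phi ^+ i) ->
  gr_in nu (ev (Phi ^+ i)) = E [:: (gm *+ i, Phi ^+ i)] /\ wf e [:: (gm *+ i, Phi ^+ i)].
Proof.
move=> gE si; have wE : w (Phi ^+ i) = Some (gm *+ i) by rewrite w_PhiX gE.
split; last by apply: gr_wf1 => //; rewrite wE vle_refl.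
by apply: gr_in_small => //; rewrite -w_v.
Qed.

Lemma phi_coef_sum (I : eqType) (r : seq I) (c : I -> {poly K}) (k : I -> nat) j :
  uniq r -> injective k -> j \in r -> (forall i, (size (c i) <= d)%N) ->
  phi_coef Phi (\sum_(i <- r) c i * Phi ^+ k i) (k j) = c j.
Proof.
have [Phim sPhi _ _] := PhiH.
move=> ur kI jr sc; rewrite (big_morph (fun p => phi_coef Phi p (k j)) (id1 := 0) (op1 := +%R)).
- rewrite (bigD1_seq j) //= (phi_coef_mulX PhiH) // eqxx big1 ?addr0 // => i ij.
  by rewrite (phi_coef_mulX PhiH) // (inj_eq kI) eq_sym (negPf ij).
- by move=> p q; exact: phi_coefD.
by rewrite /phi_coef div0p mod0p.
Qed.

Definition gr_Phi_basis : set (gr L Gamma) :=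
  [set gr_in nu (ev (Phi ^+ i)) | i in [set i | size_le e (Phi ^+ i)]].

(** A relation makes the value of a sum of terms c_i Phi^(k_i) too large; since [nu = nu_Phi] is the
    minimum over these terms, each of them is too large. *)
Lemma gr_Phi_basis_free n (a b : 'I_n -> gr L Gamma) : injective b ->
  (forall i, gr_Phi_basis (b i)) -> (forall i, G nu (Kpoly iota chi (Some d)) (a i)) ->
  gr_lincomb nu mu a b = gr0 nu -> forall i, a i = gr0 nu.
Proof.
move=> bI bB aG; have [gm gE] := gam_Some.
have /choice[k kP] : forall i, exists k, size_le e (Phi ^+ k) /\ gr_in nu (ev (Phi ^+ k)) = b i.
  by move=> i; have [k sk <-] := bB i; exists k.
have kI : injective k.
  by move=> i j kij; apply: bI; rewrite -(proj2 (kP i)) -(proj2 (kP j)) kij.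
have /choice[s sP] : forall i, exists s, gr_reps w (Some d) s /\ a i = E s.
  move=> i; have := aG i => /(gr_ofP nuu w_ultra w_v size_le_d)[s rs aE].
  by exists s.
have wfs i : wf e (s i) by apply: (gr_wf_sub size_le_d); apply: gr_reps_wf => //; case: (sP i).
pose t i := gr_conv (s i) [:: (gm *+ k i, Phi ^+ k i)].
have bE i : b i = E [:: (gm *+ k i, Phi ^+ k i)] /\ wf e [:: (gm *+ k i, Phi ^+ k i)].
  by have [sk <-] := kP i; exact: gr_in_PhiX.
have wft i : wf e (t i) by exact: (gr_wf_conv w_ultra w_mul e_closed (wfs i) (proj2 (bE i))).
have abE i : mu (a i) (b i) = E (t i).
  by have [_ ->] := sP i; have [-> wb] := bE i; rewrite gr_mulE.
have [lE wl] := gr_of_big nuu w_ultra w_v wft abE.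
rewrite /gr_lincomb lE -nilE => /(gr_of_inj nuu w_ultra w_v wl).
have ssz i h : (size (gr_coef (s i) h) <= d)%N.
  have : size_le (Some d) (gr_coef (s i) h).
    by apply: size_le_sum => x xs _; have [/(_ x xs)[]] := sP i.
  by apply.
move=> /(_ (gr_wf_nil _ _)) eq0 j; have [_ ->] := sP j.
apply: gr_of_equiv => // h.
have nil0 h' : gr_coef [::] h' = 0 :> {poly K} by rewrite /gr_coef big_nil.
(* In this degree, the component of [a j] of degree [h] is the one that multiplies [b j]. *)
have := eq0 (h + gm *+ k j); rewrite gr_coef_big !nil0 !subr0.
have tE : \sum_(i < n) gr_coef (t i) (h + gm *+ k j) =
    \sum_(i < n) gr_coef (s i) (h + gm *+ k j - gm *+ k i) * Phi ^+ k i.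
  by apply: eq_bigr => i _; rewrite gr_coef_convC gr_coef_conv big_seq1 mulrC.
rewrite tE; set p := \sum_(i < n) _.
have sp : size_le e p.
  by apply: size_le_sum => i _ _; apply: size_le_PhiX => //; case: (kP i).
rewrite w_v // v_nF // => lt.
have := vlt_le_trans lt (nuPhi_le_coef F PhiH p (k j)).
rewrite /p phi_coef_sum ?index_enum_uniq ?mem_index_enum // addrK gE.
rewrite -[Some (h + _)]/(vadd (Some h) (vmuln (Some gm) (k j))) vlt_addr // w_v //.
by apply: size_le_d => m [<-].
Qed.

Lemma gr_Phi_basis_span u : G nu (Kpoly iota chi e) u ->
  exists n (a b : 'I_n -> gr L Gamma),
    [/\ forall i, gr_Phi_basis (b i), forall i, G nu (Kpoly iota chi (Some d)) (a i)
      & u = gr_lincomb nu mu a b].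
Proof.
move=> /(gr_ofP nuu w_ultra w_v (fun p sp => sp))[s rs ->].
have [gm gE] := gam_Some; have [Phim sPhi d0 _] := PhiH.
have [m [me ms]] : exists m, (forall i, (i < m)%N -> size_le e (Phi ^+ i)) /\
    (forall x, x \in s -> (size x.2 <= m * d)%N).
  case en: e => [n|].
    have /dvdnP[m nE] := e_dvd en; exists m; split.
      by move=> i im k [<-]; rewrite (size_PhiX PhiH) nE ltn_mul2r d0.
    by move=> x /rs[sx _]; rewrite -nE; exact: sx.
  exists (\max_(x <- s) size x.2); split=> // x xs.
  by apply: leq_trans (leq_pmulr _ d0); exact: leq_bigmax_seq.
(* The shift makes up for the degree [gm *+ i] of the class of [Phi ^+ i]. *)
pose S i := [seq (x.1 - gm *+ i, phi_coef Phi x.2 i) | x <- s].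
have rS i : gr_reps w (Some d) (S i).
  move=> _ /mapP[x xs ->]; have [sx lex] := rs x xs.
  have sc : size_le (Some d) (phi_coef Phi x.2 i).
    by move=> n [<-]; exact: (size_phi_coef PhiH).
  split; first exact: sc.
  suff : vle (Some (x.1 - gm *+ i)) (w (phi_coef Phi x.2 i)) by [].
  rewrite w_v; last exact: size_le_d.
  rewrite -(@vle_addr _ (Some (gm *+ i))) // [X in vle X _]/= subrK.
  have := nuPhi_le_coef F PhiH x.2 i; rewrite gE; apply: vle_trans.
  by rewrite -v_nF // -w_v.
have wS i : wf (Some d) (S i) by apply: gr_reps_wf.
have wS' i : wf e (S i) := gr_wf_sub size_le_d (wS i).
exists m, (fun i : 'I_m => E (S i)), (fun i : 'I_m => gr_in nu (ev (Phi ^+ i))).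
have si (i : 'I_m) : size_le e (Phi ^+ i) := me i (ltn_ord i).
split=> [i|i|]; first by exists i; [exact: si|].
  by apply: gr_of_mem => //; exact: size_le_d.
pose t (i : 'I_m) := gr_conv (S i) [:: (gm *+ i, Phi ^+ i)].
have bE (i : 'I_m) := gr_in_PhiX gE (si i).
have wft i : wf e (t i) by exact: (gr_wf_conv w_ultra w_mul e_closed (wS' i) (proj2 (bE i))).
have abE (i : 'I_m) : mu (E (S i)) (gr_in nu (ev (Phi ^+ i))) = E (t i).
  by have [-> wb] := bE i; rewrite gr_mulE.
have [lE _] := gr_of_big nuu w_ultra w_v wft abE.
rewrite /gr_lincomb lE; apply: gr_of_eq => // h.
rewrite gr_coef_big /gr_coef.
transitivity (\sum_(i < m) \sum_(x <- s | x.1 == h) phi_coef Phi x.2 i * Phi ^+ i).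
  rewrite exchange_big /= big_seq_cond [RHS]big_seq_cond.
  apply: eq_bigr => x /andP[xs _].
  exact: (phi_expansion_wide PhiH (ms x xs)).
apply: eq_bigr => i _; rewrite -[RHS]/(gr_coef (t i) h) gr_coef_convC gr_coef_conv big_seq1 /=.
rewrite /gr_coef /S big_map /= mulr_sumr.
by apply: eq_big => [x|x _]; [rewrite subr_eq subrK|rewrite mulrC].
Qed.

(** Degrees do not separate the powers when [gam] is 0; the i-th coefficient of the difference,
    which is 1, does. *)
Lemma gr_Phi_basis_inj i j : size_le e (Phi ^+ i) -> size_le e (Phi ^+ j) ->
  gr_in nu (ev (Phi ^+ i)) = gr_in nu (ev (Phi ^+ j)) -> i = j.
Proof.
move=> si sj; have [gm gE] := gam_Some; have [Phim sPhi d0 _] := PhiH.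
have [-> wi] := gr_in_PhiX gE si; have [-> wj] := gr_in_PhiX gE sj.
move=> /(gr_of_inj nuu w_ultra w_v wi wj) /(_ (gm *+ i)).
rewrite /gr_coef !big_cons !big_nil /= eqxx addr0.
set q := (if _ then _ else _) => lt; apply/eqP/negPn/negP => ij.
have sq : size_le e (Phi ^+ i - q).
  by apply: size_leB => //; rewrite /q; case: ifP => _; rewrite ?addr0 //; exact: size_le0.
have s1 : (size (1%R : {poly K}) <= d)%N by rewrite size_poly1.
have ci : phi_coef Phi (Phi ^+ i - q) i = 1.
  rewrite phi_coefD phi_coefN -[Phi ^+ i]mul1r (phi_coef_mulX PhiH) // eqxx /q.
  case: ifP => _; last by rewrite /phi_coef div0p mod0p subr0.
  by rewrite addr0 -[Phi ^+ j]mul1r (phi_coef_mulX PhiH) // (negPf ij) subr0.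
move: lt; rewrite w_v // v_nF // => lt.
have := vlt_le_trans lt (nuPhi_le_coef F PhiH _ i).
by rewrite ci (v_1 F) v0add gE vltxx.
Qed.

Lemma gr_dimension :
  gr_dim_fraction nu mu (Kpoly iota chi (Some d)) (Kpoly iota chi e) e d.
Proof.
have [Phim sPhi d0 _] := PhiH.
exists gr_Phi_basis.
  split; [|exact: gr_Phi_basis_free|exact: gr_Phi_basis_span].
  move=> _ [i si <-]; have [gm gE] := gam_Some; have [-> wi] := gr_in_PhiX gE si.
  exact: gr_of_mem.
have BE : (gr_Phi_basis #= [set i | size_le e (Phi ^+ i)])%card.
  by apply: inj_card_eq => i j /set_mem si /set_mem sj; exact: gr_Phi_basis_inj.
case en: e => [n|]; last first.
  rewrite (eq_finite_set BE) => fin; apply: infinite_nat.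
  by apply: sub_finite_set fin => i _ m; rewrite en.
have /dvdnP[m nE] := e_dvd en; exists m.
  have -> : `I_m = [set i | size_le e (Phi ^+ i)]; last exact: BE.
  apply/seteqP; split=> i /=.
    by move=> im k; rewrite en => -[<-]; rewrite (size_PhiX PhiH) nE ltn_mul2r d0.
  by move=> /(_ n en); rewrite (size_PhiX PhiH) nE ltn_mul2r d0.
by rewrite nE natrM mulfK // pnatr_eq0 -lt0n.
Qed.

End GradedDimension.

(** * Choice of the auxiliary valuation, and the graded part *)

Section GradedAssembly.
Variables (K L : fieldType) (iota : {rmorphism K -> L}) (chi : L) (N : option nat).
Variables (Gamma : ordered_group) (nu : L -> option Gamma).
Local Notation ev := (ev iota chi).
Local Notation v p := (nu (ev p)).
Implicit Types a b c f g p q r : {poly K}.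
Hypothesis F : pm_facts iota chi N nu.
Hypothesis N_def : ext_degree iota chi N.
Variables (Phi : {poly K}) (d : nat).
Hypothesis Phi_key : key_poly iota chi N nu d Phi.
Hypothesis Phi_max : exists2 g, v Phi = Some g & is_max (monic_values iota chi nu d) g.
Hypothesis ddN : ltn_ext (d + d) N.
Variable d' : option nat.
Hypothesis d'_next : next_key_degree iota chi N nu d d'.
Local Notation nF := (nu_Phi iota chi nu Phi).
Local Notation jump := (jump_degree iota chi N nu Phi).

Let PhiH : monic_below N Phi d. Proof. by case: Phi_key => ? ? []. Qed.
Let d'_jump := smallest_jump_degreeP F N_def Phi_key Phi_max d'_next.

Lemma next_gt n : d' = Some n -> (d < n)%N.
Proof.
by move=> d'n; move: d'_jump; rewrite d'n => -[/(jump_gt F Phi_key Phi_max)].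
Qed.

Lemma gr_mul_closed_key w : (forall f g, w (f * g) = vadd (w f) (w g)) ->
  (forall p, (size p <= d.+1)%N -> w p = v p) -> gr_mul_closed iota chi nu w (Some d).
Proof.
move=> wM wv f g sf sg f0 g0; have {}sf := sf _ erefl; have {}sg := sg _ erefl.
have ok := small_mul_deg ddN sf sg; have [Phim sPhi _ _] := PhiH.
have vfg : v (f * g) = vadd (v f) (v g) by apply: (v_mul F); left.
have wfg : w (f * g) = v (f * g) by rewrite wM vfg !wv // leqW.
have [_ _ lt] := nuPhi_key F Phi_key sf sg ok f0 g0.
have [_ _ _ keyP] := Phi_key; have [rE lt'] := keyP f g f0 g0 sf sg ok.
have qE : f * g - (f * g) %% Phi = (f * g) %/ Phi * Phi.
  by rewrite {1}(divp_eq (f * g) Phi) addrK.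
exists ((f * g) %% Phi); split.
- by move=> _ [<-]; exact: (size_modPhi PhiH).
- have sq : (size ((f * g) %/ Phi)%R <= d)%N.
    rewrite (size_divPhi PhiH) leq_subLR size_mul //.
    by apply: leq_trans (leq_pred _) _; exact: leq_add.
  have -> : w (f * g - (f * g) %% Phi) = vadd (v Phi) (v ((f * g) %/ Phi)).
    by rewrite qE wM vaddC !wv ?sPhi // leqW.
  by rewrite wfg vfg -(nuPhi_small F PhiH sq).
- by split=> //; rewrite qE wfg rE.
Qed.

Lemma gr_mul_closed_field : field_valuation nu ->
  gr_mul_closed iota chi nu (fun p => v p) d'.
Proof.
move=> fv f g sf sg f0 g0; case d'E: d' d'_jump sf sg => [e|] /=.
  move=> [[Phi' [pm sp _ lt]] emin] /(_ e erefl) sf /(_ e erefl) sg.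
  have ok : ltn_ext (d.-1 + d.-1) N.
    by apply: ltn_ext_le ddN; apply: leq_add; exact: leq_pred.
  have ltq := jump_reduce F N_def Phi_key Phi_max pm sp lt emin sf sg f0 g0 (or_intror (conj fv ok)).
  have qE : f * g - (f * g) %% Phi' = (f * g) %/ Phi' * Phi'.
    by rewrite {1}(divp_eq (f * g) Phi') addrK.
  exists ((f * g) %% Phi'); rewrite qE; split=> //.
  by move=> _ [<-]; rewrite -ltnS -sp ltn_modp monic_neq0.
move=> nj _ _; exists (f * g); rewrite subrr ev0 (um0 (nuU F)) vltNone.
(* For algebraic [chi] the minimal polynomial would jump. *)
have NE : N = None.
  by case NE: N => [n|] //; case: (nj n); exact: (jump_ext_degree F N_def Phi_key).
have fg : v (f * g) != None.
  by apply: (v_neqNone F); [rewrite NE|rewrite mulf_neq0].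
by split.
Qed.

Lemma gr_mul_closed_nuPhi e (Phi' : {poly K}) : key_poly iota chi N nu e Phi' ->
  ltn_ext (e.-1 + e.-1) N ->
  gr_mul_closed iota chi nu (nu_Phi iota chi nu Phi') (Some e).
Proof.
move=> key' eN f g /(_ e erefl) sf /(_ e erefl) sg f0 g0.
have PhiH' : monic_below N Phi' e by case: key' => ? ? [].
have ok : ltn_ext ((size f).-1 + (size g).-1) N.
  by apply: ltn_ext_le eN; apply: leq_add; rewrite -!subn1 leq_sub2r.
have [wfg _ lt] := nuPhi_key F key' sf sg ok f0 g0.
have vfg : v (f * g) = vadd (v f) (v g) by apply: (v_mul F); left.
have [_ _ _ keyP] := key'; have [rE lt'] := keyP f g f0 g0 sf sg ok.
have qE : f * g - (f * g) %% Phi' = (f * g) %/ Phi' * Phi'.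
  by rewrite {1}(divp_eq (f * g) Phi') addrK.
exists ((f * g) %% Phi'); rewrite qE wfg; split.
- by move=> _ [<-]; exact: (size_modPhi PhiH').
- by rewrite mulrC (nuPhi_mulPhi F PhiH').
- by split=> //; rewrite -vfg rE.
Qed.

Lemma graded_module w : ultrametric w -> (forall f g, w (f * g) = vadd (w f) (w g)) ->
  (forall p, size_le d' p -> w p = v p) -> gr_mul_closed iota chi nu w d' ->
  gr_mul_available N nu d' ->
  exists mu : gr L Gamma -> gr L Gamma -> gr L Gamma,
    [/\ graded_algebra nu mu (Kpoly iota chi (Some d)),
        graded_algebra nu mu (Kpoly iota chi d')
      & gr_dim_fraction nu mu (Kpoly iota chi (Some d)) (Kpoly iota chi d') d' d].
Proof.
move=> wU wM wv cl avail; have [_ _ d0 _] := PhiH.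
have sub p : size_le (Some d) p -> size_le d' p by apply: size_le_d; exact: next_gt.
have s1 : size_le (Some d) (1 : {poly K}) by move=> _ [<-]; rewrite size_poly1.
exists (gr_mul iota chi nu d' w); split.
- apply: (gr_graded_algebra (nuU F) (nu1 F) wU wM wv sub s1 _ (nu_inj F)).
  by apply: gr_mul_closed_key => // p sp; apply: wv => n /next_gt; exact: leq_trans.
- apply: (gr_graded_algebra (nuU F) (nu1 F) wU wM wv _ (sub _ s1) cl (nu_inj F)).
  by [].
apply: (gr_dimension F wU wM wv PhiH) => //; last 1 first.
- move=> n d'n; move: d'_jump avail; rewrite d'n => -[je emin] avail.
  apply: (jump_dvd F N_def Phi_key Phi_max ddN je emin).
  by case: avail => [[_ [<-] ?]|?]; [right|left].
- move=> p sp; apply: (below_jumps_eq F N_def Phi_key Phi_max).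
  exact: (below_jumps_next F N_def Phi_key Phi_max d'_next).
exact: next_gt.
Qed.

Lemma graded_part : gr_mul_available N nu d' ->
  exists mu : gr L Gamma -> gr L Gamma -> gr L Gamma,
    [/\ graded_algebra nu mu (Kpoly iota chi (Some d)),
        graded_algebra nu mu (Kpoly iota chi d')
      & gr_dim_fraction nu mu (Kpoly iota chi (Some d)) (Kpoly iota chi d') d' d].
Proof.
move=> avail; have [[e d'E eN]|fv] := avail; last first.
  apply: (@graded_module (fun p => v p)) => //; first exact: v_ultra F.
    by move=> f g; apply: (v_mul F); right.
  exact: gr_mul_closed_field.
have [je emin] : jump e /\ forall k, jump k -> (e <= k)%N by move: d'_jump; rewrite d'E.
have de := next_gt d'E; have [_ _ d0 _] := PhiH.
(* e = N would give 2 (N - 1) < N, against e > d >= 1. *)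
have eN' : ltn_ext e N.
  case NE: N eN => [n|] //=; have := jump_leq N_def je NE.
  by move: d0 de; clear; lia.
have [Phi' [key' _]] := jump_key F N_def Phi_key Phi_max je emin eN'.
have PhiH' : monic_below N Phi' e by case: key' => ? ? [].
apply: (@graded_module (nu_Phi iota chi nu Phi')) => //.
- exact: (nuPhi_ultra F PhiH').
- by move=> f g; apply: (nuPhi_mul F key'); exact: key_mul_deg_all.
- by move=> p sp; apply: (nuPhi_small F PhiH'); exact: sp.
by rewrite d'E; exact: gr_mul_closed_nuPhi.
Qed.

End GradedAssembly.

(** * Pivots and separated bases *)

Section Defectless.
Variables (K L : fieldType) (iota : {rmorphism K -> L}) (chi : L) (N : option nat).
Variables (Gamma : ordered_group) (nu : L -> option Gamma).
Local Notation ev := (ev iota chi).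
Local Notation v p := (nu (ev p)).
Implicit Types p q : {poly K}.
Hypothesis F : pm_facts iota chi N nu.

Let nuu := nuU F.

Definition ord_cons (T : Type) n (a : T) (f : 'I_n -> T) (i : 'I_n.+1) : T :=
  oapp f a (unlift ord0 i).

Lemma ord_cons0 (T : Type) n (a : T) (f : 'I_n -> T) : ord_cons a f ord0 = a.
Proof. by rewrite /ord_cons unlift_none. Qed.

Lemma ord_cons_lift (T : Type) n (a : T) (f : 'I_n -> T) i :
  ord_cons a f (lift ord0 i) = f i.
Proof. by rewrite /ord_cons liftK. Qed.

Lemma lincomb_recl n (c : 'I_n.+1 -> K) (x : 'I_n.+1 -> L) : lincomb iota c x =
  iota (c ord0) * x ord0 + lincomb iota (fun i => c (lift ord0 i)) (fun i => x (lift ord0 i)).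
Proof. exact: big_ord_recl. Qed.

Lemma lincomb_cons n (c : 'I_n.+1 -> K) (a : L) (x : 'I_n -> L) :
  lincomb iota c (ord_cons a x) =
  iota (c ord0) * a + lincomb iota (fun i => c (lift ord0 i)) x.
Proof.
rewrite lincomb_recl ord_cons0; congr (_ + _).
by apply: eq_bigr => i _; rewrite ord_cons_lift.
Qed.

Lemma lin_span_recl n (x : 'I_n.+1 -> L) z : lin_span iota x z <->
  exists a, exists2 y, lin_span iota (fun i => x (lift ord0 i)) y & z = iota a * x ord0 + y.
Proof.
split=> [[c ->]|[a [_ [c ->] ->]]].
  rewrite lincomb_recl; exists (c ord0).
  by exists (lincomb iota (fun i => c (lift ord0 i)) (fun i => x (lift ord0 i))) => //; eexists.
exists (ord_cons a c); rewrite lincomb_recl ord_cons0; congr (_ + _).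
by apply: eq_bigr => i _; rewrite ord_cons_lift.
Qed.

Definition submodule (M : set L) : Prop :=
  M 0 /\ forall a y z, M y -> M z -> M (iota a * y + z).

Lemma Kpoly_submodule e : submodule (Kpoly iota chi e).
Proof.
split; first by exists 0; [exact: size_le0|rewrite ev0].
move=> a _ _ [p sp ->] [q sq ->]; exists (a *: p + q); last by rewrite evD evZ.
by apply: size_leD => // n en; apply: leq_trans (size_scale_leq _ _) (sp n en).
Qed.

Lemma nu_scale a y : Kpoly iota chi None y -> nu (iota a * y) = vadd (nu (iota a)) (nu y).
Proof. by move=> [p _ ->]; rewrite -evZ (v_scale F). Qed.

Lemma nu_iotaM a b : nu (iota (a * b)) = vadd (nu (iota a)) (nu (iota b)).
Proof. by rewrite rmorphM nu_scale //; exists b%:P => //; rewrite evC. Qed.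

(* phi is a coordinate in which x attains its value; its kernel is orthogonal to x. *)
Definition pivot (M : set L) (x : L) (phi : L -> K) : Prop :=
  [/\ forall a y z, M y -> M z -> phi (iota a * y + z) = a * phi y + phi z,
      phi x = 1
    & forall y, M y -> vle (nu y) (vadd (nu (iota (phi y))) (nu x))].

Definition has_pivots (M : set L) : Prop :=
  forall x, M x -> x != 0 -> exists phi, pivot M x phi.

Lemma submodule_lincomb (M : set L) n (c : 'I_n -> K) (x : 'I_n -> L) :
  submodule M -> (forall i, M (x i)) -> M (lincomb iota c x).
Proof.
move=> [M0 Ml] Mx; rewrite /lincomb; elim/big_rec: _ => // i y _ My.
exact: Ml.
Qed.

Lemma pivot_lincomb (M : set L) y phi n (c : 'I_n -> K) (x : 'I_n -> L) :
  submodule M -> pivot M y phi -> (forall i, M (x i)) -> (forall i, phi (x i) = 0) ->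
  phi (lincomb iota c x) = 0.
Proof.
move=> [M0 Ml] [lin _ _] Mx px.
have p0 : phi 0 = 0.
  have := lin 1 0 0 M0 M0; rewrite mulr0 addr0 mul1r => /eqP.
  by rewrite -subr_eq0 opprD addNKr oppr_eq0 => /eqP.
suff [] : M (lincomb iota c x) /\ phi (lincomb iota c x) = 0 by [].
rewrite /lincomb; elim/big_rec: _ => // i z _ [Mz pz]; split; first exact: Ml.
by rewrite lin // px mulr0 pz addr0.
Qed.

Lemma has_pivots_defectless (M : set L) : submodule M -> M `<=` Kpoly iota chi None ->
  has_pivots M -> vs_defectless iota nu M.
Proof.
move=> subM MK piv; elim=> [|m IHm] x Mx.
  exists 0, x; split; last by move=> c; rewrite /lincomb !big_ord0 (um0 nuu).
  by split=> // c _ [].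
have [x0|x0] := eqVneq (x ord0) 0.
  have [n [l [[lF lS] lsep]]] := IHm (fun i => x (lift ord0 i)) (fun i => Mx _).
  exists n, l; split=> //; split=> //; rewrite lS; apply/seteqP; split=> z.
    by move=> sz; apply/lin_span_recl; exists 0, z; rewrite ?rmorph0 ?mul0r ?add0r.
  by move=> /lin_span_recl[a [y sy ->]]; rewrite x0 mulr0 add0r.
have [phi phiP] := piv _ (Mx ord0) x0; have [lin phi1 lephi] := phiP.
have [M0 Ml] := subM.
(* The remaining generators are projected to the kernel of [phi] along [x ord0]. *)
pose x' (i : 'I_m) := iota (- phi (x (lift ord0 i))) * x ord0 + x (lift ord0 i).
have Mx' i : M (x' i) by apply: Ml.
have px' i : phi (x' i) = 0 by rewrite lin // phi1 mulr1 addNr.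
have [n [l [[lF lS] lsep]]] := IHm x' Mx'.
have lspan (c : 'I_n -> K) : M (lincomb iota c l) /\ phi (lincomb iota c l) = 0.
  have [c' ->] : lin_span iota x' (lincomb iota c l) by rewrite -lS; exists c.
  by split; [exact: submodule_lincomb|exact: pivot_lincomb phiP _ _].
have phi_cons (c : 'I_n.+1 -> K) : phi (lincomb iota c (ord_cons (x ord0) l)) = c ord0.
  have [Ml' pl] := lspan (fun i => c (lift ord0 i)).
  by rewrite lincomb_cons lin // phi1 mulr1 pl addr0.
exists n.+1, (ord_cons (x ord0) l); split; first split.
- move=> c c0 i; have c00 : c ord0 = 0.
    rewrite -phi_cons c0; have := lin 1 0 0 M0 M0; rewrite mulr0 addr0 mul1r => /eqP.
    by rewrite -subr_eq0 opprD addNKr oppr_eq0 => /eqP.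
  case: (unliftP ord0 i) => [j ->|-> //].
  apply: (lF (fun j => c (lift ord0 j))).
  by move: c0; rewrite lincomb_cons c00 rmorph0 mul0r add0r.
- have x'E c : lincomb iota c x' = iota (- \sum_i c i * phi (x (lift ord0 i))) * x ord0
      + lincomb iota c (fun i => x (lift ord0 i)).
    rewrite rmorphN rmorph_sum mulNr mulr_suml -sumrN -big_split; apply: eq_bigr => i _ /=.
    by rewrite /x' mulrDr rmorphN rmorphM mulNr mulrN mulrA.
  apply/seteqP; split=> z.
    move=> /lin_span_recl[a [y [c ->] ->]]; rewrite ord_cons0.
    have -> : (fun i => ord_cons (x ord0) l (lift ord0 i)) = l.
      by apply/funext => i; rewrite ord_cons_lift.
    have [c' ->] : lin_span iota x' (lincomb iota c l) by rewrite -lS; exists c.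
    rewrite x'E addrA -mulrDl -rmorphD; apply/lin_span_recl.
    by eexists; eexists; last by []; exists c'.
  move=> /lin_span_recl[a [y [c ->] ->]]; apply/lin_span_recl.
  have -> : (fun i => ord_cons (x ord0) l (lift ord0 i)) = l.
    by apply/funext => i; rewrite ord_cons_lift.
  rewrite ord_cons0; exists (a + \sum_i c i * phi (x (lift ord0 i))), (lincomb iota c x').
    by rewrite lS; exists c.
  rewrite x'E addrA -mulrDl -rmorphD addrK //.
move=> c; rewrite big_ord_recl ord_cons0.
under eq_bigr => i _ do rewrite ord_cons_lift.
rewrite -(lsep (fun i => c (lift ord0 i))).
have [My py] := lspan (fun i => c (lift ord0 i)).
have := phi_cons c; rewrite lincomb_cons.
set y := lincomb _ _ l in My py *; set u := iota (c ord0) * x ord0 => pc.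
have Mu : M u by rewrite /u -[iota _ * _]addr0; exact: Ml.
have Muy : M (u + y) by exact: Ml.
(* [phi (u + y)] is [c ord0], so the pivot bounds nu(u + y) by nu(u); then [y = (u + y) - u] gives
   the same bound by nu(y). *)
have leu : vle (nu (u + y)) (nu u).
  by have := lephi _ Muy; rewrite pc -nu_scale //; exact/MK/Mx.
apply: vle_anti; last by case: nuu => _ _; apply.
have yE : y = u + y - u by rewrite addrC addKr.
rewrite vle_vmin leu [X in vle _ (nu X)]yE.
by apply: (um_leB nuu) => //; exact: vle_refl.
Qed.

Lemma separated_pivots (M : set L) n (l : 'I_n -> L) : M `<=` Kpoly iota chi None ->
  is_lin_basis iota M l -> separated iota nu l -> has_pivots M.
Proof.
move=> MK [lF lS] lsep.
have Ml i : M (l i) by rewrite -lS; exact: lin_span_self.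
have /choice[c cP] : forall y, exists c, M y -> y = lincomb iota c l.
  move=> y; have [My|nM] := pselect (M y); last by exists (fun=> 0).
  by move: My; rewrite -lS => -[c yE]; exists c.
have cu y c' : M y -> y = lincomb iota c' l -> forall i, c y i = c' i.
  move=> My yE i; apply/eqP; rewrite -subr_eq0; apply/eqP.
  apply: (lF (fun i => c y i - c' i)); rewrite /lincomb.
  under eq_bigr => j _ do rewrite rmorphB mulrBl.
  by rewrite sumrB; apply/eqP; rewrite subr_eq0 -[X in _ == X]yE {2}(cP y My).
move=> x Mx x0; have nx : nu x != None by apply: contra_neq x0; exact: nu_inj F _.
have xE := lsep (c x); rewrite -(cP x Mx) in xE.
have [j nuxE] : exists j, nu x = nu (iota (c x j) * l j).
  by rewrite xE in nx *; exact: bigvmin_attained nx.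
have cx0 : c x j != 0.
  by apply: contra_neq nx => c0; rewrite nuxE c0 rmorph0 mul0r (um0 nuu).
(* [j] is a coordinate where the minimum giving nu(x) is attained; separatedness bounds nu(y) by its
   j-th term. *)
exists (fun y => c y j / c x j); split.
- move=> a y z My Mz; rewrite mulrA -mulrDl; congr (_ / _).
  have yzE : iota a * y + z = lincomb iota (fun i => a * c y i + c z i) l.
    rewrite {1}(cP y My) {1}(cP z Mz) /lincomb mulr_sumr -big_split; apply: eq_bigr => i _ /=.
    by rewrite rmorphD rmorphM mulrDl mulrA.
  rewrite (cu _ _ _ yzE) // yzE -lS; by eexists.
- by rewrite divff.
move=> y My; have yE := lsep (c y); rewrite -(cP y My) in yE.
rewrite {1}yE; apply: vle_trans (bigvmin_vle _ j) _.
rewrite nuxE !nu_scale; [|exact/MK|exact/MK].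
by rewrite vaddA -nu_iotaM divfK // vle_refl.
Qed.

Lemma powers_span d : lin_span iota (fun i : 'I_d => chi ^+ i) = Kpoly iota chi (Some d).
Proof.
apply/seteqP; split=> z.
  by move=> [c ->]; have [p [sp _] ->] := lincomb_ev iota chi c; exists p => // n [<-].
by move=> [p sp ->]; exists (fun i => p`_i); apply: ev_wide; exact: sp.
Qed.

(** K_{d-1}[chi] is itself finitely generated, so one separated basis of it serves every element. *)
Lemma defectless_pivots d : vs_defectless iota nu (Kpoly iota chi (Some d)) ->
  has_pivots (Kpoly iota chi (Some d)).
Proof.
move=> /(_ d (fun i => chi ^+ i)) H.
have [i|n [l [lB lsep]]] := H; first by rewrite -powers_span; exact: lin_span_self (fun i => chi ^+ i) i.
apply: (separated_pivots _ _ lsep); first by move=> y [p _ ->]; exists p.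
by rewrite -powers_span.
Qed.

(** Choose i where the minimum nu_Phi(p) is attained and a pivot [psi] at the i-th coefficient of p;
    the new coordinate is [psi] of the i-th coefficient. For every y, nu(y) is at most the i-th term
    of its expansion, to which the bound of [psi] applies. *)
Lemma expansion_pivots (Phi : {poly K}) d e : monic_below N Phi d ->
  (forall p, size_le e p -> ltn_ext (size p).-1 N) ->
  (forall p, size_le e p -> v p = nu_Phi iota chi nu Phi p) ->
  has_pivots (Kpoly iota chi (Some d)) -> has_pivots (Kpoly iota chi e).
Proof.
move=> PhiH eN v_nF piv _ [p sp ->] evp0.
have p0 : v p != None by apply: contra_neq evp0; exact: nu_inj F _.
have [i pE] : exists i, v p = vadd (v (phi_coef Phi p i)) (vmuln (v Phi) i).
  by rewrite v_nF // in p0 *; exact: nuPhi_att p0.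
have Kc q : Kpoly iota chi (Some d) (ev (phi_coef Phi q i)).
  by exists (phi_coef Phi q i) => // n [<-]; exact: (size_phi_coef PhiH).
have c0 : ev (phi_coef Phi p i) != 0.
  by apply: contra_neq p0 => c0; rewrite pE c0 (um0 nuu).
have [psi [lin psi1 lepsi]] := piv _ (Kc p) c0.
(* [rp] recovers a polynomial from its value at [chi]; it is unique because the degrees are below
   [N]. *)
pose rp y := xget 0 [set q | size_le e q /\ y = ev q].
have rpE q : size_le e q -> rp (ev q) = q.
  move=> sq; have : exists q', size_le e q' /\ ev q = ev q' by exists q.
  rewrite /rp => /(xgetPex 0)[]; set q' := xget _ _ => sq' qq'.
  apply/eqP; rewrite -subr_eq0; apply/eqP/(ev_inj F).
    by apply: eN; exact: size_leB.
  by rewrite evB qq' subrr.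
exists (fun y => psi (ev (phi_coef Phi (rp y) i))); split.
- move=> a _ _ [q sq ->] [r sr ->]; rewrite -evZ -evD !rpE //.
    by rewrite phi_coefD phi_coefZ evD evZ lin.
  apply: size_leD => // n en; exact: leq_trans (size_scale_leq _ _) (sq n en).
- by rewrite rpE.
move=> _ [q sq ->]; rewrite rpE // pE v_nF // vaddA.
apply: vle_trans (nuPhi_le_coef F PhiH q i) _; apply: vle_add; last exact: vle_refl.
exact: lepsi.
Qed.

End Defectless.

Theorem theorem4p10 (K L : fieldType) (iota : {rmorphism K -> L}) (chi : L)
    (N : option nat) (Gamma : porderZmodType) (nu : L -> option Gamma)
    (d : nat) (d' : option nat) (Phi : {poly K})
    (L_gen : generated_by_chi iota chi)
    (chi_notin_K : forall a : K, iota a != chi)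
    (N_def : ext_degree iota chi N)
    (Gamma_ordered : linearly_ordered_group Gamma)
    (nu_pm : pm_valuation iota chi N nu)
    (nuK_rank : finite_rank (value_set nu (range iota)))
    (d_key : independent_key_degree iota chi N nu d)
    (Phi_monic : Phi \is monic) (Phi_size : size Phi = d.+1)
    (Phi_max : exists2 g, nu (ev iota chi Phi) = Some g
                        & is_max (monic_values iota chi nu d) g)
    (d'_next : next_key_degree iota chi N nu d d') :
  [/\ key_poly iota chi N nu d Phi /\
        smallest_jump_degree iota chi N nu Phi d',
      forall p : {poly K}, (forall n, d' = Some n -> (size p <= n)%N) ->
        nu (ev iota chi p) = nu_Phi iota chi nu Phi p,
      ltn_ext (d + d) N -> gr_mul_available N nu d' ->
        exists mu : gr L Gamma -> gr L Gamma -> gr L Gamma,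
          [/\ graded_algebra nu mu (Kpoly iota chi (Some d)),
              graded_algebra nu mu (Kpoly iota chi d')
            & gr_dim_fraction nu mu (Kpoly iota chi (Some d))
                (Kpoly iota chi d') d' d]
    & vs_defectless iota nu (Kpoly iota chi (Some d)) ->
      vs_defectless iota nu (Kpoly iota chi d')].
Proof.
pose Gam := OrderedGroup Gamma_ordered.
have F : pm_facts iota chi N (nu : L -> option Gam) by exact: pm_factsP.
have Phi_key : key_poly iota chi N nu d Phi.
  exact: (@max_is_key K L iota chi N Gam).
have PhiH : monic_below N Phi d by case: Phi_key => ? ? [].
have below p : size_le d' p -> below_jumps iota chi N (nu : L -> option Gam) Phi p.
  exact: (below_jumps_next F N_def Phi_key Phi_max d'_next).
have v_nF p : size_le d' p -> nu (ev iota chi p) = nu_Phi iota chi nu Phi p.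
  by move=> /below; exact: (below_jumps_eq F N_def Phi_key Phi_max).
split.
- split=> //; exact: (smallest_jump_degreeP F N_def Phi_key Phi_max d'_next).
- exact: v_nF.
- move=> ddN; exact: (graded_part F N_def Phi_key Phi_max ddN d'_next).
move=> /(defectless_pivots F) piv.
apply: (has_pivots_defectless F); first exact: Kpoly_submodule.
  by move=> _ [p _ ->]; exists p.
apply: (expansion_pivots F PhiH) piv => // p /below.
exact: (below_jumps_lt F N_def Phi_key Phi_max).
Qed.
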